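(* Let $\theta$ be an inner function and let $G\in L^\infty$. (i) $\overline z\in\ker D^\theta_G$ if and only if $G \in z K_\theta \cap L^\infty$; moreover $zK_\theta\cap L^\infty\subset z H^\infty$. (ii) If the equivalent conditions in (i) hold and $G \ne 0$, then $\ker D^\theta_G = \overline z\, \overline I\, K_{zI} = \overline z\, \overline{K_{zI}}$, where $G=zIO$ with $I$ inner and $O$ outer is the inner--outer factorization.
   Context: $L^2=L^2(\mathbb T)$, $L^\infty=L^\infty(\mathbb T)$, where $\mathbb T$ is the unit circle; $H^2_+=H^2(\mathbb D)$ and $H^\infty$ are the Hardy spaces of the disc identified with boundary functions on $\mathbb T$; $H^2_-=L^2\ominus H^2_+$; bars denote complex conjugation on $\mathbb T$, and the bar of a set of functions is the set of conjugates. For an inner function $\beta$, $K_\beta=H^2_+\ominus\beta H^2_+$. Put $K_\theta^\perp=L^2\ominus K_\theta=H^2_-\oplus\theta H^2_+$ and let $Q_\theta$ be the orthogonal projection of $L^2$ onto $K_\theta^\perp$. The dual truncated Toeplitz operator with symbol $G\in L^\infty$ is $D^\theta_G:K_\theta^\perp\to K_\theta^\perp$, $D^\theta_G f=Q_\theta(Gf)$. *)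

(* Defs.v *)
From HB Require Import structures.
From mathcomp Require Import all_boot all_order all_algebra.
From mathcomp Require Import all_classical all_reals all_analysis.
From mathcomp Require Import complex.
Set Implicit Arguments.
Unset Strict Implicit.
Unset Printing Implicit Defensive.
Import Order.TTheory GRing.Theory Num.Theory.
Import numFieldNormedType.Exports.
Local Open Scope classical_set_scope.
Local Open Scope ring_scope.

(* A function F on the unit circle is represented by f : R -> R[i] with
   f t = F (e^{it}); only the values on the arc [0, 2 pi] matter.  Elements of
   the Lebesgue spaces are represented by measurable functions and compared
   with =ae, so every set of functions below is stable under =ae between
   measurable functions. *)

Section CircleFunctions.
Context {R : realType}.
Implicit Types (f g h u : R -> R[i]) (M N : set (R -> R[i])).

Definition arc : set R := `[0, 2 * pi].

Definition aeq f g : Prop := ae_eq lebesgue_measure arc f g.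

Definition cmeasurable f : Prop :=
  measurable_fun arc (fun t => complex.Re (f t)) /\
  measurable_fun arc (fun t => complex.Im (f t)).

Definition zT : R -> R[i] := fun t => Complex (cos t) (sin t).

Definition fmul f g : R -> R[i] := fun t => f t * g t.
Definition fconj f : R -> R[i] := fun t => conjc (f t).

(* Integration against the normalized arc length dt / (2 pi). *)
Definition cintegral f : R[i] :=
  Complex ((2 * pi)^-1 * \int[lebesgue_measure]_(t in arc) complex.Re (f t))
          ((2 * pi)^-1 * \int[lebesgue_measure]_(t in arc) complex.Im (f t)).

Definition dot f g : R[i] := cintegral (fmul f (fconj g)).

Definition L2 : set (R -> R[i]) := [set f | cmeasurable f /\
  (\int[lebesgue_measure]_(t in arc) ((Normc.normc (f t)) ^+ 2)%:E
     < +oo)%E].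

Definition Linfty : set (R -> R[i]) := [set f | cmeasurable f /\
  exists C : R, {ae lebesgue_measure,
    forall t, arc t -> Normc.normc (f t) <= C}].

(* H^2_+ as a space of boundary functions: the f in L^2 whose Fourier
   coefficients of negative index vanish. *)
Definition H2 : set (R -> R[i]) := [set f | L2 f /\
  forall n : nat, dot f (fun t => conjc (zT t) ^+ n.+1) = 0].

Definition Hinfty : set (R -> R[i]) := H2 `&` Linfty.

Definition inner u : Prop := Hinfty u /\
  {ae lebesgue_measure, forall t, arc t -> Normc.normc (u t) = 1}.

(* Outer function of H^2: a cyclic vector of the shift, i.e. the closed linear
   span in L^2 of the functions z^n g, n >= 0, is H^2_+. *)
Definition outer g : Prop := H2 g /\
  forall h, H2 h -> forall e : R, 0 < e -> exists p : {poly R[i]},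
    (\int[lebesgue_measure]_(t in arc)
       ((Normc.normc (h t - p.[zT t] * g t)) ^+ 2)%:E < e%:E)%E.

(* M (-) N; N need not be closed nor contained in M. *)
Definition ominus M N : set (R -> R[i]) :=
  [set f | M f /\ forall g, N g -> dot f g = 0].

(* u M = { u g : g in M }, as classes modulo =ae. *)
Definition smul u M : set (R -> R[i]) :=
  [set f | cmeasurable f /\ exists2 g, M g & aeq f (fmul u g)].

(* The set of conjugates of the elements of M. *)
Definition sconj M : set (R -> R[i]) := [set fconj f | f in M].

Definition Kspace u : set (R -> R[i]) := ominus H2 (smul u H2).

Definition Kperp u : set (R -> R[i]) := ominus L2 (Kspace u).

(* g represents the orthogonal projection of f onto M. *)
Definition orthproj M f g : Prop :=
  M g /\ forall h, M h -> dot (fun t => f t - g t) h = 0.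

(* The graph of the dual truncated Toeplitz operator on K_u^perp with symbol G:
   g represents Q_u (G f).  It is a relation because g is determined only up
   to =ae. *)
Definition dualTT u G f g : Prop :=
  Kperp u f /\ orthproj (Kperp u) (fmul G f) g.

Definition kerD u G : set (R -> R[i]) := [set f | dualTT u G f (fun=> 0)].

End CircleFunctions.

(* Main.v *)
Require Import Defs.
From mathcomp Require Import all_boot all_order all_algebra.
From mathcomp Require Import all_classical all_reals all_analysis.
From mathcomp Require Import measurable_realfun complex ring lra.
Set Implicit Arguments.
Unset Strict Implicit.
Unset Printing Implicit Defensive.
Import Order.TTheory GRing.Theory Num.Theory.
Import numFieldNormedType.Exports.
Import Normc.
Local Open Scope classical_set_scope.
Local Open Scope ring_scope.

(** Why the theorem holds. Write z for the coordinate function and H2minus for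
    the orthogonal complement of H^2 in L^2.

    Part (i). The operator kills f in K_theta^perp exactly when G f is orthogonal
    to the whole of K_theta^perp. Testing against the negative powers of z and against
    theta H^2, which all lie in K_theta^perp, shows that this means
    G f \in K_theta ([kerDP]). For f = conj z this is the first claim. The second
    holds because dividing G by z keeps it bounded.

    Part (ii). Put G = z v g with v inner and g outer; g is bounded because
    |g| = |G|. All three sets are shown to consist of the f in H2minus with
    z v f \in H^2. For the two sets on the right ([mem_conj_Kspace],
    [mem_sconj_Kspace]) this is a computation: multiplication by z v is
    isometric, and f lies in H2minus iff conj (z f) lies in H^2.

    For the kernel, let k = theta conj G; it is in H^infty since
    G conj z is in K_theta. One inclusion is direct: G f = g (z v f) is in H^2,
    and <G f, theta h> = <f, k h> = 0 for h in H^2. Conversely let f be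
    orthogonal to K_theta with G f \in K_theta, so that f is orthogonal to k H^2.
    The product conj g z^n is a polynomial with leading term
    conj (mean of g) z^n plus a remainder r in H2minus ([conj_mulX_split]).
    As theta conj g z^n = k (z v z^n) is in k H^2, the function theta r is in
    K_theta, and both are orthogonal to f; since the mean of an outer function
    is nonzero, induction on n gives that f is orthogonal to every theta z^n.
    The same splitting of conj theta z^n puts z^n in
    K_theta + theta (polynomials), so f is orthogonal to every z^n, hence to
    H^2 ([Kperp_orth_theta_zX]). Finally (z v f) g = G f is in H^2, and an outer
    factor can be divided out because p_n g -> 1 for suitable polynomials p_n
    ([outer_div]).

    The analytic input is that a function of L^2 orthogonal to all z^n, n >= 0,
    is orthogonal to H^2 ([orth_zX_H2]). It follows from the density of
    Laurent polynomials in L^2 ([L2_laurent_limit]): by Pythagoras the analytic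
    part of a Laurent polynomial approximates an element of H^2 at least as well
    as the whole. Density comes from indicators of initial segments of the arc,
    each of which is, up to a null set, an affine image of the sign of a
    trigonometric polynomial of modulus at most 1; iterating
    x |-> (3 x - x^3) / 2 turns such a polynomial into its sign. The pi-lambda
    theorem and simple functions do the rest. *)

Section DualTruncatedToeplitzKernel.
Context {R : realType}.
Implicit Types (f g h u : R -> R[i]).
Local Notation mu := (@lebesgue_measure R).
Local Notation arc := (@Defs.arc R).
Local Notation Re := complex.Re.
Local Notation Im := complex.Im.
Local Notation z := (@zT R).

(** * Modulus and conjugation *)

Lemma normc_sqE (x : R[i]) : normc x ^+ 2 = Re x ^+ 2 + Im x ^+ 2.
Proof. by case: x => a b /=; rewrite sqr_sqrtr ?addr_ge0 ?sqr_ge0. Qed.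

Lemma cReD (x y : R[i]) : Re (x + y) = Re x + Re y.
Proof. by case: x; case: y. Qed.

Lemma cImD (x y : R[i]) : Im (x + y) = Im x + Im y.
Proof. by case: x; case: y. Qed.

Lemma cReM (x y : R[i]) : Re (x * y) = Re x * Re y - Im x * Im y.
Proof. by case: x; case: y. Qed.

Lemma cImM (x y : R[i]) : Im (x * y) = Re x * Im y + Im x * Re y.
Proof. by case: x; case: y. Qed.

Lemma normc_conj (x : R[i]) : normc (conjc x) = normc x.
Proof. by case: x => a b /=; rewrite sqrrN. Qed.

Lemma normc_ge0 (x : R[i]) : 0 <= normc x.
Proof. by case: x => a b /=; exact: sqrtr_ge0. Qed.

Lemma sq_normcM (x y : R[i]) : normc (x * y) ^+ 2 = normc x ^+ 2 * normc y ^+ 2.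
Proof. by rewrite normcM exprMn. Qed.

Lemma normcD (x y : R[i]) : normc (x + y) <= normc x + normc y.
Proof. by rewrite -lecR rmorphD; exact: (ler_normD x y). Qed.

Lemma conjcM (x y : R[i]) : conjc (x * y) = conjc x * conjc y.
Proof. exact: rmorphM. Qed.

Lemma conjcX (x : R[i]) n : conjc (x ^+ n) = conjc x ^+ n.
Proof. exact: rmorphXn. Qed.

Lemma conjcB (x y : R[i]) : conjc (x - y) = conjc x - conjc y.
Proof. exact: rmorphB. Qed.

Lemma normc_real (x : R) : normc x%:C%C ^+ 2 = x ^+ 2.
Proof. by rewrite normc_sqE /= expr0n addr0. Qed.

Lemma real_complexB (x y : R) : x%:C%C - y%:C%C = (x - y)%:C%C :> R[i].
Proof. by apply/eqP; rewrite eq_complex /= subr0 !eqxx. Qed.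

Lemma normc_zT (t : R) : normc (zT t) = 1.
Proof. by rewrite /= cos2Dsin2 sqrtr1. Qed.

Lemma conjc_mul_unit (x : R[i]) : normc x = 1 -> conjc x * x = 1.
Proof.
move=> x1; have : normc x ^+ 2 = 1 by rewrite x1 expr1n.
rewrite normc_sqE; case: x {x1} => a b /= E.
by apply/eqP; rewrite eq_complex /=; apply/andP; split; apply/eqP; [rewrite -E|]; ring.
Qed.

Lemma conjc_zT_mul (t : R) : conjc (zT t) * zT t = 1.
Proof. by rewrite conjc_mul_unit// normc_zT. Qed.

Lemma conjc_zTX_mul (t : R) n : conjc (zT t) ^+ n * zT t ^+ n = 1.
Proof. by rewrite -exprMn conjc_zT_mul expr1n. Qed.

(** * The spaces L^2 and L^infty of the arc *)

Lemma measurable_arc : measurable arc.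
Proof. exact: measurable_itv. Qed.

Hint Extern 0 (measurable _) => solve [exact: measurable_arc] : core.

Lemma measure_arc : (mu arc = (2 * pi)%:E)%E.
Proof.
by rewrite /Defs.arc lebesgue_measure_itv/= lte_fin mulr_gt0 ?pi_gt0//= -EFinB subr0.
Qed.

Lemma arc_finite : (mu arc < +oo)%E.
Proof. by rewrite measure_arc ltry. Qed.

Lemma ae_imp (P Q : R -> Prop) : (forall t, P t -> Q t) ->
  {ae mu, forall t, arc t -> P t} -> {ae mu, forall t, arc t -> Q t}.
Proof. by move=> PQ; apply: (@filterS _ _ (ae_filter_ringOfSetsType mu)) => t + At =>
  /(_ At); exact: PQ. Qed.

Lemma ae_imp2 (P Q S : R -> Prop) : (forall t, P t -> Q t -> S t) ->
  {ae mu, forall t, arc t -> P t} -> {ae mu, forall t, arc t -> Q t} ->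
  {ae mu, forall t, arc t -> S t}.
Proof.
by move=> PQ; apply: (@filterS2 _ _ (ae_filter_ringOfSetsType mu)) => t + + At => /(_
  At) + /(_ At); exact: PQ.
Qed.

Definition cintegrable f := mu.-integrable arc (EFin \o (fun t => Re (f t))) /\
  mu.-integrable arc (EFin \o (fun t => Im (f t))).

Lemma cmeasurable_cst c : cmeasurable (fun _ : R => c).
Proof. by split; exact: measurable_cst. Qed.

Lemma cmeasurableD f g : cmeasurable f -> cmeasurable g ->
  cmeasurable (fun t => f t + g t).
Proof.
move=> [f1 f2] [g1 g2]; split; under eq_fun do rewrite ?cReD ?cImD.
  exact: measurable_funD.
exact: measurable_funD.
Qed.

Lemma cmeasurableM f g : cmeasurable f -> cmeasurable g -> cmeasurable (fmul f g).
Proof.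
move=> [f1 f2] [g1 g2]; split; rewrite /fmul; under eq_fun do rewrite ?cReM ?cImM.
  by apply: measurable_funB; exact: measurable_funM.
by apply: measurable_funD; exact: measurable_funM.
Qed.

Lemma cmeasurable_conj f : cmeasurable f -> cmeasurable (fconj f).
Proof.
move=> [f1 f2]; split.
  by rewrite [X in measurable_fun _ X](_ : _ = (fun t => Re (f t))) //;
    apply/funext=> t; rewrite /fconj; case: (f t).
rewrite [X in measurable_fun _ X](_ : _ = (fun t => - Im (f t))); last first.
   by apply/funext=> t; rewrite /fconj; case: (f t).
exact: measurable_funN.
Qed.

Lemma cmeasurable_real (u : R -> R) : measurable_fun arc u ->
  cmeasurable (fun t => (u t)%:C%C).
Proof. by move=> mu_; split => //=; exact: measurable_cst. Qed.

Lemma cmeasurable_z : cmeasurable (@zT R).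
Proof.
by split; apply: measurable_funTS; apply: continuous_measurable_fun;
  [exact: continuous_cos|exact: continuous_sin].
Qed.

Definition sqnorm f : \bar R := (\int[mu]_(t in arc) ((normc (f t)) ^+ 2)%:E)%E.

Lemma measurable_sq_normc f : cmeasurable f ->
  measurable_fun arc (fun t => normc (f t) ^+ 2).
Proof.
move=> [f1 f2]; under eq_fun do rewrite normc_sqE.
by apply: measurable_funD; exact: measurable_funX.
Qed.

Lemma measurable_sq_normc_EFin f : cmeasurable f ->
  measurable_fun arc (fun t => (normc (f t) ^+ 2)%:E).
Proof. by move=> /measurable_sq_normc ?; exact/measurable_EFinP. Qed.

Lemma sqnorm_ge0 f : (0 <= sqnorm f)%E.
Proof. by apply: integral_ge0 => t _; rewrite lee_fin sqr_ge0. Qed.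

(** The one comparison principle for squared norms; the additive and
    multiplicative bounds below are instances. *)
Lemma sqnorm_le (a b : R) f g h : cmeasurable f -> cmeasurable g -> cmeasurable h ->
  0 <= a -> 0 <= b ->
  {ae mu, forall t, arc t -> normc (h t) ^+ 2 <= a * normc (f t) ^+ 2 + b * normc (g t)
    ^+ 2} ->
  (sqnorm h <= a%:E * sqnorm f + b%:E * sqnorm g)%E.
Proof.
move=> mf mg mh a0 b0 H; rewrite /sqnorm.
have E (k : R -> R[i]) (c : R) : cmeasurable k -> 0 <= c ->
  (c%:E * (\int[mu]_(t in arc) (normc (k t) ^+ 2)%:E) =
   \int[mu]_(t in arc) (c * normc (k t) ^+ 2)%:E)%E.
  move=> mk c0; rewrite -ge0_integralZl_EFin//.
  - by move=> t _; rewrite lee_fin sqr_ge0.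
  - exact: measurable_sq_normc_EFin.
have mZ (k : R -> R[i]) (c : R) : cmeasurable k ->
   measurable_fun arc (fun t => c * normc (k t) ^+ 2).
  by move=> mk; apply: measurable_funM;
    [exact: measurable_cst|exact: measurable_sq_normc].
rewrite !E// -ge0_integralD//; last 4 first.
- by move=> t _; rewrite lee_fin mulr_ge0 // sqr_ge0.
- by apply/measurable_EFinP; exact: mZ.
- by move=> t _; rewrite lee_fin mulr_ge0 // sqr_ge0.
- by apply/measurable_EFinP; exact: mZ.
apply: ae_ge0_le_integral => //.
- by move=> t _; rewrite lee_fin sqr_ge0.
- exact: measurable_sq_normc_EFin.
- by move=> t _; rewrite -EFinD lee_fin addr_ge0// mulr_ge0 // sqr_ge0.
- by apply: emeasurable_funD; apply/measurable_EFinP; exact: mZ.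
Qed.

Lemma sqnorm_add f g : cmeasurable f -> cmeasurable g ->
  (sqnorm (fun t => f t + g t)%R <= 2%:E * sqnorm f + 2%:E * sqnorm g)%E.
Proof.
move=> mf mg; apply: sqnorm_le => //; first exact: cmeasurableD.
apply/aeW => t _; rewrite !normc_sqE cReD cImD.
have := sqr_ge0 (Re (f t) - Re (g t)); have := sqr_ge0 (Im (f t) - Im (g t)).
nra.
Qed.

Lemma sqnorm_ae f g : cmeasurable f -> cmeasurable g -> aeq f g -> sqnorm f = sqnorm g.
Proof.
move=> mf mg fg; have := measurable_sq_normc_EFin mf;
  have := measurable_sq_normc_EFin mg => hg hf.
apply: ge0_ae_eq_integral => //; try by move=> t _; rewrite lee_fin sqr_ge0.
exact: (ae_eq_comp (fun x => (normc x ^+ 2)%:E) fg).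
Qed.

Lemma L2_ae f g : L2 f -> cmeasurable g -> aeq f g -> L2 g.
Proof. by move=> [mf nf] mg fg; split => //; have := sqnorm_ae mf mg fg;
  rewrite /sqnorm => <-. Qed.

Lemma L2_le f g : L2 f -> cmeasurable g ->
  (forall t, arc t -> normc (g t) ^+ 2 <= normc (f t) ^+ 2) -> L2 g.
Proof.
move=> Lf mg H; split => //; apply: le_lt_trans Lf.2; apply: ge0_le_integral => //.
- by move=> t _; rewrite lee_fin sqr_ge0.
- exact: measurable_sq_normc_EFin mg.
- exact: measurable_sq_normc_EFin Lf.1.
Qed.

Lemma L2D f g : L2 f -> L2 g -> L2 (fun t => f t + g t).
Proof.
move=> [mf nf] [mg ng]; split; first exact: cmeasurableD.
by apply: (le_lt_trans (sqnorm_add mf mg)); rewrite lte_add_pinfty// lte_mul_pinfty.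
Qed.

Lemma sqnormM_bdd u f (C : R) : cmeasurable u -> cmeasurable f ->
  {ae mu, forall t, arc t -> normc (u t) <= C} -> 0 <= C ->
  (sqnorm (fmul u f) <= (C ^+ 2)%:E * sqnorm f)%E.
Proof.
move=> mu_ mf uC C0.
have := @sqnorm_le (C ^+ 2) 0 f f (fmul u f) mf mf (cmeasurableM mu_ mf) (sqr_ge0 _)
  (lexx _).
rewrite mul0e adde0; apply; move: uC; apply: ae_imp => t H.
rewrite sq_normcM mul0r addr0 ler_wpM2r ?sqr_ge0//.
by rewrite ler_sqr ?nnegrE// normc_ge0.
Qed.

Lemma L2M_bdd u f : Linfty u -> L2 f -> L2 (fmul u f).
Proof.
move=> [mu_ [C uC]] [mf nf]; split; first exact: cmeasurableM.
have uC' : {ae mu, forall t, arc t -> normc (u t) <= Num.max C 0}.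
  by move: uC; apply: ae_imp => t H; rewrite le_max H.
apply: (le_lt_trans (sqnormM_bdd mu_ mf uC' _)); first by rewrite le_max lexx orbT.
by rewrite lte_mul_pinfty// lee_fin sqr_ge0.
Qed.

Lemma Linfty_cst c : Linfty (fun _ : R => c).
Proof. by split; [exact: cmeasurable_cst|exists (normc c); apply: aeW]. Qed.

Lemma L2_cst c : L2 (fun _ : R => c).
Proof.
split; first exact: cmeasurable_cst.
rewrite (_ : (\int[_]_(t in _) _ = (normc c ^+ 2)%:E * mu arc)%E);
  last exact: integral_cst.
by rewrite lte_mul_pinfty// ?lee_fin ?sqr_ge0//; exact: arc_finite.
Qed.

Lemma Linfty_L2 u : Linfty u -> L2 u.
Proof.
move=> Lu; have := L2M_bdd Lu (L2_cst 1); congr (L2 _).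
by apply/funext => t; rewrite /fmul mulr1.
Qed.

Lemma LinftyM f g : Linfty f -> Linfty g -> Linfty (fmul f g).
Proof.
move=> [mf [C fC]] [mg [D gD]]; split; first exact: cmeasurableM.
exists (C * D); move: fC gD; apply: ae_imp2 => t H1 H2.
by rewrite normcM ler_pM ?normc_ge0.
Qed.

Lemma LinftyD f g : Linfty f -> Linfty g -> Linfty (fun t => f t + g t).
Proof.
move=> [mf [C fC]] [mg [D gD]]; split; first exact: cmeasurableD.
exists (C + D); move: fC gD; apply: ae_imp2 => t H1 H2.
by apply: le_trans (normcD _ _) _; exact: lerD.
Qed.

Lemma Linfty_ae f g : Linfty f -> cmeasurable g -> aeq f g -> Linfty g.
Proof.
move=> [mf [C fC]] mg fg; split=> //; exists C.
by move: fC fg; apply: ae_imp2 => t H1 <-.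
Qed.

Lemma Linfty_conj f : Linfty f -> Linfty (fconj f).
Proof.
move=> [mf [C fC]]; split; first exact: cmeasurable_conj.
by exists C; move: fC; apply: ae_imp => t H1; rewrite normc_conj.
Qed.

Lemma sqnorm_conj f : sqnorm (fconj f) = sqnorm f.
Proof. by rewrite /sqnorm; under eq_integral do rewrite normc_conj. Qed.

Lemma L2_conj f : L2 f -> L2 (fconj f).
Proof.
by move=> [mf nf]; split; [exact: cmeasurable_conj|rewrite -/(sqnorm _) sqnorm_conj].
Qed.

Lemma Linfty_z : Linfty (@zT R).
Proof.
by split; [exact: cmeasurable_z|exists 1; apply: aeW => t _; rewrite normc_zT].
Qed.

Lemma LinftyX u n : Linfty u -> Linfty (fun t => u t ^+ n).
Proof.
move=> Lu; elim: n => [|n IH].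
  by under eq_fun do rewrite expr0; exact: Linfty_cst.
by under eq_fun do rewrite exprS; exact: LinftyM.
Qed.

Lemma Linfty_horner u (q : {poly R[i]}) : Linfty u -> Linfty (fun t => q.[u t]).
Proof.
move=> Lu; elim/poly_ind: q => [|p c IH].
  by under eq_fun do rewrite horner0; exact: Linfty_cst.
under eq_fun do rewrite !hornerE.
exact: (LinftyD (LinftyM IH Lu) (Linfty_cst c)).
Qed.

Lemma L2Z c f : L2 f -> L2 (fun t => c * f t).
Proof. by move=> Lf; exact: L2M_bdd (Linfty_cst c) Lf. Qed.

Lemma sqnormZ c f : cmeasurable f ->
  sqnorm (fun t => c * f t)%R = ((normc c ^+ 2)%:E * sqnorm f)%E.
Proof.
move=> mf; rewrite /sqnorm -ge0_integralZl_EFin//.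
- by apply: eq_integral => t _; rewrite sq_normcM EFinM.
- by move=> t _; rewrite lee_fin sqr_ge0.
- exact: measurable_sq_normc_EFin.
- exact: sqr_ge0.
Qed.

Lemma L2B f g : L2 f -> L2 g -> L2 (fun t => f t - g t).
Proof.
move=> Lf Lg; have := L2D Lf (L2Z (-1) Lg); congr (L2 _).
by apply/funext => t; rewrite mulN1r.
Qed.

(** * The normalized complex integral *)

Lemma L2_sq_integrable f : L2 f ->
  mu.-integrable arc (EFin \o (fun t => normc (f t) ^+ 2)).
Proof.
move=> [mf nf]; apply/integrableP; split; first exact: measurable_sq_normc_EFin.
apply: le_lt_trans nf; rewrite le_eqVlt; apply/orP; left; apply/eqP.
by apply: eq_integral => t _; rewrite /= ger0_norm ?sqr_ge0.
Qed.

Lemma normr_ReM_le (x y : R[i]) : `|Re (x * y)| <= normc x ^+ 2 + normc y ^+ 2.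
Proof.
case: x y => a b [c d]; rewrite !normc_sqE/= ler_norml; apply/andP; split.
  have := sqr_ge0 (a + c); have := sqr_ge0 (b - d).
  have := sqr_ge0 a; have := sqr_ge0 b; have := sqr_ge0 c; have := sqr_ge0 d; nra.
have := sqr_ge0 (a - c); have := sqr_ge0 (b + d).
have := sqr_ge0 a; have := sqr_ge0 b; have := sqr_ge0 c; have := sqr_ge0 d; nra.
Qed.

Lemma normr_ImM_le (x y : R[i]) : `|Im (x * y)| <= normc x ^+ 2 + normc y ^+ 2.
Proof.
case: x y => a b [c d]; rewrite !normc_sqE/= ler_norml; apply/andP; split.
  have := sqr_ge0 (a + d); have := sqr_ge0 (b + c).
  have := sqr_ge0 a; have := sqr_ge0 b; have := sqr_ge0 c; have := sqr_ge0 d; nra.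
have := sqr_ge0 (a - d); have := sqr_ge0 (b - c).
have := sqr_ge0 a; have := sqr_ge0 b; have := sqr_ge0 c; have := sqr_ge0 d; nra.
Qed.

Lemma L2_mul_integrable f g : L2 f -> L2 g -> cintegrable (fmul f g).
Proof.
move=> Lf Lg; have [mf1 mf2] := cmeasurableM Lf.1 Lg.1.
have I := integrableD (mu:=mu) measurable_arc (L2_sq_integrable Lf) (L2_sq_integrable
  Lg).
split; apply: le_integrable I => //; try exact/measurable_EFinP; move=> t _;
  rewrite /= lee_fin [leRHS]ger0_norm ?addr_ge0 ?sqr_ge0//.
  exact: normr_ReM_le.
exact: normr_ImM_le.
Qed.

Lemma L2_integrable f : L2 f -> cintegrable f.
Proof.
move=> Lf; have := L2_mul_integrable Lf (L2_cst 1); congr (cintegrable _).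
by apply/funext => t; rewrite /fmul mulr1.
Qed.

Lemma cintegralD f g : cintegrable f -> cintegrable g ->
  cintegral (fun t => f t + g t) = cintegral f + cintegral g.
Proof.
move=> [f1 f2] [g1 g2]; rewrite /cintegral; simpc.
rewrite -!mulrDr -!RintegralD//.
by congr (Complex (_ * _) (_ * _)); apply: eq_Rintegral => t _; rewrite ?cReD ?cImD.
Qed.

Lemma cintegrableZ c f : cintegrable f -> cintegrable (fun t => c * f t).
Proof.
move=> [f1 f2]; split.
  have := integrableB (mu:=mu) measurable_arc (integrableZl (mu:=mu) measurable_arc (Re
    c) f1) (integrableZl (mu:=mu) measurable_arc (Im c) f2).
  by congr (_.-integrable _ _); apply/funext => t /=; rewrite cReM.
have := integrableD (mu:=mu) measurable_arc (integrableZl (mu:=mu) measurable_arc (Re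
  c) f2) (integrableZl (mu:=mu) measurable_arc (Im c) f1).
by congr (_.-integrable _ _); apply/funext => t /=; rewrite cImM.
Qed.

Lemma cintegralZ c f : cintegrable f ->
  cintegral (fun t => c * f t) = c * cintegral f.
Proof.
move=> [f1 f2]; rewrite /cintegral.
have E1 : \int[mu]_(t in arc) Re (c * f t) =
   Re c * \int[mu]_(t in arc) Re (f t) - Im c * \int[mu]_(t in arc) Im (f t).
  rewrite -!RintegralZl// -RintegralB//.
  - by apply: eq_Rintegral => t _; rewrite cReM.
  - exact: (integrableZl (mu:=mu) measurable_arc (Re c) f1).
  - exact: (integrableZl (mu:=mu) measurable_arc (Im c) f2).
have E2 : \int[mu]_(t in arc) Im (c * f t) =
   Re c * \int[mu]_(t in arc) Im (f t) + Im c * \int[mu]_(t in arc) Re (f t).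
  rewrite -!RintegralZl// -RintegralD//.
  - by apply: eq_Rintegral => t _; rewrite cImM.
  - exact: (integrableZl (mu:=mu) measurable_arc (Re c) f2).
  - exact: (integrableZl (mu:=mu) measurable_arc (Im c) f1).
rewrite E1 E2; case: c {E1 E2} => a b /=; simpc; congr Complex; ring.
Qed.

Lemma cintegralB f g : cintegrable f -> cintegrable g ->
  cintegral (fun t => f t - g t) = cintegral f - cintegral g.
Proof.
move=> If Ig; rewrite -mulN1r -cintegralZ// -cintegralD//; last exact: cintegrableZ.
by congr cintegral; apply/funext => t; rewrite mulN1r.
Qed.

Lemma cintegral_ae f g : cmeasurable f -> cmeasurable g -> aeq f g ->
  cintegral f = cintegral g.
Proof.
move=> [f1 f2] [g1 g2] fg; rewrite /cintegral /Rintegral.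
congr (Complex (_ * fine _) (_ * fine _)); apply: ae_eq_integral => //;
  try exact/measurable_EFinP.
  exact: (ae_eq_comp (fun x : R[i] => (Re x)%:E) fg).
exact: (ae_eq_comp (fun x : R[i] => (Im x)%:E) fg).
Qed.

Lemma cintegral_cst c : cintegral (fun _ : R => c) = c.
Proof.
have P : (2 * pi : R) != 0 by rewrite mulf_neq0// gt_eqF// pi_gt0.
have E r : \int[mu]_(t in arc) r = r * (2 * pi).
  transitivity (r * fine (mu arc)); first exact: Rintegral_cst.
  by rewrite measure_arc.
by rewrite /cintegral !E; case: c => a b /=; congr Complex; rewrite mulrC mulfK.
Qed.

Lemma cintegral_conj f : cintegrable f -> cintegral (fconj f) = conjc (cintegral f).
Proof.
move=> [f1 f2]; rewrite /cintegral /=; congr Complex.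
  by congr (_ * _); apply: eq_Rintegral => t _; rewrite /fconj; case: (f t).
rewrite -mulrN; congr (_ * _); rewrite -mulN1r -RintegralZl//.
by apply: eq_Rintegral => t _; rewrite /fconj mulN1r; case: (f t).
Qed.

(** The inequality Re (x y) <= s |x|^2 + |y|^2 / s replaces Cauchy-Schwarz: first
    s, then the size of g, is chosen so small that a positive real part a would
    be at most a / 4 + a / 4. *)
Lemma Re_small f c : L2 f ->
  (forall e : R, 0 < e -> exists g,
    [/\ L2 g, (sqnorm g < e%:E)%E & cintegral (fmul f g) = c]) ->
  Re c <= 0.
Proof.
move=> Lf H; rewrite leNgt; apply/negP => a0; set a := Re c in a0.
pose F := \int[mu]_(t in arc) (normc (f t) ^+ 2).
have F0 : 0 <= F by apply: Rintegral_ge0 => t _; exact: sqr_ge0.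
pose K : R := (2 * pi)^-1.
have K0 : 0 < K by rewrite invr_gt0 mulr_gt0// pi_gt0.
(* F + 1 rather than F keeps s positive when f vanishes *)
pose s := a / (4 * K * (F + 1)).
have s0 : 0 < s by rewrite divr_gt0// !mulr_gt0// ltr_wpDl.
pose e := s * a / (4 * K).
have e0 : 0 < e by rewrite divr_gt0// mulr_gt0.
have [g [Lg ge gc]] := H _ e0.
have [I _] := L2_mul_integrable Lf Lg.
have If := L2_sq_integrable Lf; have Ig := L2_sq_integrable Lg.
have B : \int[mu]_(t in arc) Re (fmul f g t) <= s * F + s^-1 * \int[mu]_(t in arc)
  (normc (g t) ^+ 2).
  rewrite -!RintegralZl// -RintegralD//; last 2 first.
  - exact: (integrableZl (mu:=mu) measurable_arc s If).
  - exact: (integrableZl (mu:=mu) measurable_arc s^-1 Ig).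
  apply: le_Rintegral => //.
    exact: (integrableD (mu:=mu) measurable_arc (integrableZl (mu:=mu) measurable_arc s
      If) (integrableZl (mu:=mu) measurable_arc s^-1 Ig)).
  move=> t _; rewrite /fmul cReM !normc_sqE.
  case: (f t) (g t) => p q [u v] /=.
  have si0 : 0 < s^-1 by rewrite invr_gt0.
  have s2 : 0 <= s / 2 by rewrite mulr_ge0 ?invr_ge0// ltW.
  have si2 : 0 <= s^-1 / 2 by rewrite mulr_ge0 ?invr_ge0 ?ltW.
  have E : s * (p ^+ 2 + q ^+ 2) + s^-1 * (u ^+ 2 + v ^+ 2) - (p * u - q * v) =
     s / 2 * (p ^+ 2 + q ^+ 2) + s^-1 / 2 * (u ^+ 2 + v ^+ 2) + s / 2 * (p - s^-1 * u)
       ^+ 2 +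
       s / 2 * (q + s^-1 * v) ^+ 2.
    by field; rewrite gt_eqF.
  rewrite -subr_ge0 E; apply: addr_ge0; last by apply: mulr_ge0; rewrite ?sqr_ge0.
  apply: addr_ge0; last by apply: mulr_ge0; rewrite ?sqr_ge0.
  by apply: addr_ge0; apply: mulr_ge0 => //; rewrite addr_ge0 ?sqr_ge0.
have Ge : \int[mu]_(t in arc) (normc (g t) ^+ 2) < e.
  rewrite /Rintegral -lte_fin fineK//; apply: integrable_fin_num => //.
have aE : a = K * \int[mu]_(t in arc) Re (fmul f g t) by rewrite /a -gc.
have : a <= K * (s * F) + K * (s^-1 * e).
  rewrite aE -mulrDr ler_pM2l//; apply: le_trans B _;
    rewrite lerD2l ler_pM2l ?invr_gt0//; exact: ltW.
have -> : K * (s^-1 * e) = a / 4 by rewrite /e; field; rewrite !gt_eqF.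
have -> : K * (s * F) = (a / 4) * (F / (F + 1)).
  by rewrite /s; field; rewrite !gt_eqF// ltr_wpDl.
have : F / (F + 1) <= 1 by rewrite ler_pdivrMr ?mul1r ?ltr_wpDl// lerDl.
nra.
Qed.

(** Continuity of the pairing in its second argument, phrased so that the value
    c is shared by arbitrarily small g. Rotating f by 1, -1, i and -i reduces
    the claim to the sign of the real part. *)
Lemma cintegral_small f c : L2 f ->
  (forall e : R, 0 < e -> exists g,
    [/\ L2 g, (sqnorm g < e%:E)%E & cintegral (fmul f g) = c]) ->
  c = 0.
Proof.
move=> Lf H.
have T d : Re (d * c) <= 0.
  apply: (Re_small (f := fun t => d * f t)); first exact: L2Z.
  move=> e /H [g [Lg ge gc]]; exists g; split=> //; rewrite -gc -cintegralZ;
    last exact: L2_mul_integrable.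
  by congr cintegral; apply/funext => t; rewrite /fmul mulrA.
have := T 1; have := T (-1); have := T 'i%C; have := T (- 'i%C).
case: c {H T} => a b; simpc => /= h1 h2 h3 h4.
apply/eqP; rewrite eq_complex /=; apply/andP; split; apply/eqP; lra.
Qed.

(** * Limits of Laurent polynomials in L^2 *)

Definition laurent f := exists (N : nat) (q : {poly R[i]}),
  forall t, f t = conjc (zT t) ^+ N * q.[zT t].

Lemma laurent_poly (q : {poly R[i]}) : laurent (fun t => q.[zT t]).
Proof. by exists 0%N, q => t; rewrite expr0 mul1r. Qed.

Lemma laurent_cst c : laurent (fun=> c).
Proof. by exists 0%N, c%:P => t; rewrite hornerC mul1r. Qed.

Lemma laurent_conjz : laurent (fconj (@zT R)).
Proof. by exists 1%N, 1%:P => t; rewrite hornerC mulr1. Qed.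

Lemma laurentM f g : laurent f -> laurent g -> laurent (fmul f g).
Proof.
move=> [N [p fE]] [M [q gE]]; exists (N + M)%N, (p * q) => t.
by rewrite /fmul fE gE hornerM exprD; ring.
Qed.

Lemma laurentD f g : laurent f -> laurent g -> laurent (fun t => f t + g t).
Proof.
move=> [N [p fE]] [M [q gE]]; exists (N + M)%N, ('X^M * p + 'X^N * q) => t.
rewrite fE gE !hornerE exprD.
transitivity (conjc (zT t) ^+ N * p.[zT t] * (conjc (zT t) ^+ M * zT t ^+ M)
  + conjc (zT t) ^+ M * q.[zT t] * (conjc (zT t) ^+ N * zT t ^+ N)).
  by rewrite !conjc_zTX_mul !mulr1.
by ring.
Qed.

Lemma laurent_Linfty f : laurent f -> Linfty f.
Proof.
move=> [N [p fE]].
have := LinftyM (LinftyX N (Linfty_conj Linfty_z)) (Linfty_horner p Linfty_z).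
by congr (Linfty _); apply/funext => t; rewrite fE.
Qed.

Lemma laurent_cos (s : R) : laurent (fun t => (cos (t - s))%:C%C).
Proof.
pose w : R[i] := Complex (cos s) (sin s).
have := laurentD (laurentM (laurent_cst (conjc w * (2^-1)%:C%C)) (laurent_poly 'X))
  (laurentM (laurent_cst (w * (2^-1)%:C%C)) laurent_conjz).
congr (laurent _); apply/funext => t; rewrite /fmul /fconj hornerX /w /zT cosB.
rewrite /= ; simpc; congr Complex; by field.
Qed.

Definition laurent_limit f := L2 f /\ forall e : R, 0 < e ->
  exists p, laurent p /\ (sqnorm (fun t => f t - p t)%R < e%:E)%E.

Lemma sqnorm0 : sqnorm (fun=> 0 : R[i]) = 0%E.
Proof.
by rewrite /sqnorm; under eq_integral do rewrite normc0 expr0n/=; rewrite integral0.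
Qed.

Lemma laurent_limit_laurent f : laurent f -> laurent_limit f.
Proof.
move=> lf; split; first exact/Linfty_L2/laurent_Linfty.
move=> e e0; exists f; split=> //; under eq_fun do rewrite subrr.
by rewrite sqnorm0 lte_fin.
Qed.

(** The set of limits is closed, so later constructions may pass through
    intermediate approximations. *)
Lemma laurent_limit_closed f : L2 f ->
  (forall e : R, 0 < e -> exists g, laurent_limit g /\ (sqnorm (fun t => f t - g t)%R <
    e%:E)%E) ->
  laurent_limit f.
Proof.
move=> Lf H; split=> // e e0.
have e40 : 0 < e / 4 by rewrite divr_gt0.
have [g [[Lg /(_ _ e40)[p [lp gp]] fg]]] := H _ e40.
exists p; split=> //.
have Lp := Linfty_L2 (laurent_Linfty lp).
have := sqnorm_add (L2B Lf Lg).1 (L2B Lg Lp).1.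
rewrite (_ : (fun t => _) = (fun t => f t - p t)); last by apply/funext => t; ring.
move=> /le_lt_trans; apply.
have -> : (e%:E = 2%:E * (e / 4)%:E + 2%:E * (e / 4)%:E)%E.
  by rewrite -!EFinM -EFinD; congr EFin; field.
by apply: lteD; rewrite lte_pmul2l.
Qed.

Lemma laurent_limit_ae f g : laurent_limit f -> cmeasurable g -> aeq f g ->
  laurent_limit g.
Proof.
move=> af mg fg; have Lg := L2_ae af.1 mg fg; apply: laurent_limit_closed => // e e0.
exists f; split=> //; rewrite (_ : sqnorm _ = sqnorm (fun=> 0));
  first by rewrite sqnorm0.
apply: sqnorm_ae; [exact: (L2B Lg af.1).1|exact: cmeasurable_cst|].
by move: fg; apply: ae_imp => t ->; rewrite subrr.
Qed.

Lemma laurent_limitD f g : laurent_limit f -> laurent_limit g ->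
  laurent_limit (fun t => f t + g t).
Proof.
move=> [Lf af] [Lg ag]; split; first exact: L2D.
move=> e e0; have e40 : 0 < e / 4 by rewrite divr_gt0.
have [p [lp fp]] := af _ e40; have [q [lq gq]] := ag _ e40.
exists (fun t => p t + q t); split; first exact: laurentD.
have Lp := Linfty_L2 (laurent_Linfty lp).
have Lq := Linfty_L2 (laurent_Linfty lq).
have := sqnorm_add (L2B Lf Lp).1 (L2B Lg Lq).1.
rewrite (_ : (fun t => _) = (fun t => f t + g t - (p t + q t)));
  last by apply/funext => t; ring.
move=> /le_lt_trans; apply.
have -> : (e%:E = 2%:E * (e / 4)%:E + 2%:E * (e / 4)%:E)%E.
  by rewrite -!EFinM -EFinD; congr EFin; field.
by apply: lteD; rewrite lte_pmul2l.
Qed.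

Lemma laurent_limitZ c f : laurent_limit f -> laurent_limit (fun t => c * f t).
Proof.
move=> [Lf af]; split; first exact: L2Z.
move=> e e0; pose k := normc c ^+ 2 + 1.
have k0 : 0 < k by rewrite ltr_wpDl// sqr_ge0.
have [p [lp fp]] := af (e / k) (divr_gt0 e0 k0).
exists (fun t => c * p t); split; first exact: (laurentM (laurent_cst c) lp).
have Lp := Linfty_L2 (laurent_Linfty lp).
rewrite (_ : (fun t => _) = (fun t => c * (f t - p t))); last by apply/funext => t;
  ring.
rewrite sqnormZ; last exact: (L2B Lf Lp).1.
apply: (@le_lt_trans _ _ (k%:E * sqnorm (fun t => f t - p t)%R)%E).
  by apply: lee_wpmul2r; [exact: sqnorm_ge0|rewrite lee_fin lerDl].
rewrite (_ : e%:E = (k%:E * (e / k)%:E)%E); last first.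
  by rewrite -EFinM mulrC divfK// gt_eqF.
by rewrite lte_pmul2l// lte_fin.
Qed.

Definition rlaurent_limit (u : R -> R) := laurent_limit (fun t => (u t)%:C%C).

(** Dominated convergence for (u - u_ n)^2, with dominating function 4 b^2. *)
Lemma rlaurent_limit_dominated (u_ : nat -> R -> R) (u b : R -> R) :
  (forall n, rlaurent_limit (u_ n)) -> L2 (fun t => (b t)%:C%C) ->
  (forall n t, arc t -> `|u_ n t| <= b t) ->
  (forall t, arc t -> u_ ^~ t @ \oo --> u t) ->
  rlaurent_limit u.
Proof.
move=> au Lb ub uu.
have mun n : measurable_fun arc (u_ n) by have [[[? _] _] _] := au n.
have mu_ : measurable_fun arc u by exact: measurable_fun_cvg uu.
have ulb t : arc t -> `|u t| <= b t.
  move=> At; have : `|u_ n t| @[n --> \oo] --> `|u t| by apply: cvg_norm; exact: uu.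
  move=> /(cvg_lim (@Rhausdorff R)) <-; apply: limr_le.
    by apply: is_cvg_norm; apply/cvg_ex; exists (u t); exact: uu.
  by apply: nearW => n; exact: ub.
have Lu : L2 (fun t => (u t)%:C%C).
  apply: (L2_le Lb); first exact: cmeasurable_real.
  move=> t At; rewrite !normc_real -real_normK ?num_real// ler_sqr ?nnegrE ?ulb//.
  by rewrite (le_trans _ (ulb t At)).
apply: laurent_limit_closed => // e e0.
have mdn n : cmeasurable (fun t => (u t)%:C%C - (u_ n t)%:C%C).
  by apply: (L2B Lu _).1; exact: (au n).1.
have := @dominated_convergence _ _ _ mu arc measurable_arc
  (fun n t => (normc ((u t)%:C%C - (u_ n t)%:C%C) ^+ 2)%:E) (cst 0%E)
  (fun t => (4%:E * (normc (b t)%:C%C ^+ 2)%:E)%E).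
case.
- by move=> n; exact: measurable_sq_normc_EFin.
- exact: measurable_cst.
- apply: aeW => t At; apply: cvg_EFin; first by near=> n.
  rewrite [X in X @ _](_ : _ = (fun n => (u t - u_ n t) ^+ 2)); last first.
    by apply/funext => n; rewrite /comp; cbv beta iota;
      rewrite real_complexB normc_real.
  have D : (fun n => u t - u_ n t) @ \oo --> u t - u t by apply: cvgB;
    [exact: cvg_cst|exact: uu].
  have := cvgM D D; rewrite subrr mulr0;
    rewrite (_ : _ \* _ = (fun n => (u t - u_ n t) ^+ 2)) //.
  by apply; exact: eventually_filter.
- exact: (integrableZl (mu:=mu) measurable_arc 4 (L2_sq_integrable Lb)).
- apply: aeW => t n At; rewrite real_complexB !normc_real -EFinM /= lee_fin ger0_norm
  ?sqr_ge0//.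
  have := ub n t At; have := ulb t At; rewrite !ler_norml => /andP[h1 h2] /andP[h3 h4].
  nra.
move=> _ _; rewrite integral0 => H.
have N : nbhs (0 : \bar R) [set y | (y < e%:E)%E].
  by apply: open_nbhs_nbhs; split; [exact: open_ereal_lt_ereal|rewrite /= lte_fin].
have [n _ /(_ n (leqnn n)) Hn] := H _ N.
by exists (fun t => (u_ n t)%:C%C); split; [exact: au|exact: Hn].
Unshelve. all: by end_near. Qed.

(** * Indicators of initial segments of the arc *)

(** The Newton-Schulz iteration for the sign: the fixed points 1 and -1 attract
    ]0, 1] and [-1, 0[, so its iterates are odd polynomials converging pointwise
    to the sign on [-1, 1]. *)
Definition sgstep (x : R) : R := (3 * x - x ^+ 3) / 2.

Lemma sgstep_le1 x : `|x| <= 1 -> `|sgstep x| <= 1.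
Proof.
rewrite !ler_norml /sgstep => /andP[h1 h2]; apply/andP; split; rewrite -subr_ge0.
  have -> : (3 * x - x ^+ 3) / 2 - -1 = (x + 1) ^+ 2 * (2 - x) / 2 by field.
  by apply: mulr_ge0 => //; apply: mulr_ge0; [exact: sqr_ge0|lra].
have -> : 1 - (3 * x - x ^+ 3) / 2 = (x - 1) ^+ 2 * (x + 2) / 2 by field.
by apply: mulr_ge0 => //; apply: mulr_ge0; [exact: sqr_ge0|lra].
Qed.

Lemma iter_sgstep_le1 n x : `|x| <= 1 -> `|iter n sgstep x| <= 1.
Proof. by move=> x1; elim: n => //= n; exact: sgstep_le1. Qed.

Lemma iter_sgstepN n x : iter n sgstep (- x) = - iter n sgstep x.
Proof. by elim: n => //= n ->; rewrite /sgstep; field. Qed.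

(** The iterates increase, and
    1 - sgstep y = (1 - y) (1 - y (1 + y) / 2) contracts the distance to 1 by at
    least the factor 1 - x / 2. *)
Lemma iter_sgstep_rate n x : 0 < x -> x <= 1 ->
  x <= iter n sgstep x <= 1 /\ 1 - iter n sgstep x <= (1 - x / 2) ^+ n.
Proof.
move=> x0 x1; elim: n => [|n [/andP[h1 h2] h3]] /=.
  by rewrite lexx x1 expr0; split => //; lra.
set y := iter n sgstep x in h1 h2 h3 *.
split; first (apply/andP; split).
- have E : sgstep y - y = y * (1 - y) * (1 + y) / 2 by rewrite /sgstep; field.
  apply: (le_trans h1); rewrite -subr_ge0 E; apply: mulr_ge0 => //;
    do ?apply: mulr_ge0; lra.
- have := @sgstep_le1 y; rewrite !ler_norml => H.
  by have /andP[] : -1 <= sgstep y <= 1 by apply: H; apply/andP; split; lra.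
- have -> : 1 - sgstep y = (1 - y) * (1 - y * (1 + y) / 2) by rewrite /sgstep; field.
  rewrite exprSr ler_pM//; [lra|nra|nra].
Qed.

Lemma iter_sgstep_cvg x : `|x| <= 1 -> (fun n => iter n sgstep x) @ \oo --> Num.sg x.
Proof.
have pos (y : R) : 0 < y -> y <= 1 -> (fun n => iter n sgstep y) @ \oo --> (1 : R).
  move=> y0 y1.
  have H : (fun n => (1 - y / 2) ^+ n) @ \oo --> (0 : R).
    apply: cvg_expr; rewrite ger0_norm; lra.
  have H1 : (fun n => 1 - (1 - y / 2) ^+ n) @ \oo --> (1 : R).
    have C1 : (fun=> 1 : R) @ \oo --> (1 : R) by exact: cvg_cst.
    by have := cvgB C1 H; rewrite subr0; apply.
  apply: (@squeeze_cvgr _ _ _ _ (fun n => 1 - (1 - y / 2) ^+ n) (fun=> 1));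
    [near=> n|exact: H1|exact: cvg_cst].
  have [/andP[_ h2] h3] := iter_sgstep_rate n y0 y1.
  by rewrite h2 andbT lerBlDr -lerBlDl.
rewrite ler_norml => /andP[h1 h2]; have [x0|x0|->] := ltgtP x 0.
- rewrite ltr0_sg//.
  have xN0 : 0 < - x by rewrite oppr_gt0.
  have xN1 : - x <= 1 by lra.
  rewrite (_ : (fun n => _) = (fun n => - iter n sgstep (- x))); last first.
    by apply/funext => n; rewrite iter_sgstepN opprK.
  by apply: cvgN; exact: pos.
- by rewrite gtr0_sg//; exact: pos.
- rewrite sgr0; apply: cvg_near_cst; apply: nearW => n.
  by elim: n => //= n ->; rewrite /sgstep mulr0 expr0n subrr mul0r.
Unshelve. all: by end_near. Qed.

Definition rlaurent (u : R -> R) := laurent (fun t => (u t)%:C%C).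

Lemma rlaurentD (u v : R -> R) : rlaurent u -> rlaurent v ->
  rlaurent (fun t => u t + v t).
Proof.
move=> lu lv; have := laurentD lu lv; congr (laurent _); apply/funext => t.
by apply/eqP; rewrite eq_complex /= addr0 !eqxx.
Qed.

Lemma rlaurentM (u v : R -> R) : rlaurent u -> rlaurent v ->
  rlaurent (fun t => u t * v t).
Proof.
move=> lu lv; have := laurentM lu lv; congr (laurent _); apply/funext => t.
by rewrite /fmul; simpc.
Qed.

Lemma rlaurent_cst (c : R) : rlaurent (fun=> c).
Proof. exact: laurent_cst. Qed.

Lemma rlaurent_iter_sgstep n (u : R -> R) : rlaurent u ->
  rlaurent (fun t => iter n sgstep (u t)).
Proof.
move=> lu; elim: n => //= n IH; rewrite /sgstep.
have := rlaurentD (rlaurentM (rlaurent_cst (3 / 2)) IH)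
 (rlaurentM (rlaurent_cst (- 2^-1)) (rlaurentM IH (rlaurentM IH IH))).
by congr (rlaurent _); apply/funext => t; field.
Qed.

Lemma rlaurent_limitD (u v : R -> R) : rlaurent_limit u -> rlaurent_limit v ->
  rlaurent_limit (fun t => u t + v t).
Proof.
move=> lu lv; have := laurent_limitD lu lv; congr (laurent_limit _); apply/funext => t.
by apply/eqP; rewrite eq_complex /= addr0 !eqxx.
Qed.

Lemma rlaurent_limitZ c (u : R -> R) : rlaurent_limit u ->
  rlaurent_limit (fun t => c * u t).
Proof.
move=> lu; have := laurent_limitZ c%:C%C lu; congr (laurent_limit _); apply/funext => t.
by simpc.
Qed.

Lemma rlaurent_limit_cst (c : R) : rlaurent_limit (fun=> c).
Proof. exact/laurent_limit_laurent/laurent_cst. Qed.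

Lemma rlaurent_limit_sg (u : R -> R) : rlaurent u -> (forall t, arc t -> `|u t| <= 1) ->
  rlaurent_limit (fun t => Num.sg (u t)).
Proof.
move=> lu u1; apply: (@rlaurent_limit_dominated (fun n t => iter n sgstep (u t)) _
  (fun=> 1)).
- by move=> n; apply: laurent_limit_laurent; exact: rlaurent_iter_sgstep.
- exact: L2_cst.
- by move=> n t At; apply: iter_sgstep_le1; exact: u1.
- by move=> t At; apply: iter_sgstep_cvg; exact: u1.
Qed.

Lemma rlaurent_limit_ae (u v : R -> R) : rlaurent_limit u -> measurable_fun arc v ->
  {ae mu, forall t, arc t -> u t = v t} -> rlaurent_limit v.
Proof.
move=> au mv uv; apply: laurent_limit_ae au _ _; first exact: cmeasurable_real.
by move: uv; apply: ae_imp => t ->.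
Qed.

Lemma rlaurent_limit_eq (u v : R -> R) : rlaurent_limit u -> (forall t, arc t ->
  u t = v t) -> rlaurent_limit v.
Proof.
move=> au uv; apply: (rlaurent_limit_ae au); last exact: aeW.
by have [[[m _] _] _] := au; apply: eq_measurable_fun m => t; rewrite inE => /uv.
Qed.

(** For 0 < x <= 2 pi the product sin (t / 2) sin ((x - t) / 2), which equals
    (cos (t - x / 2) - cos (x / 2)) / 2, is a trigonometric polynomial in t,
    positive on ]0, x[ and negative on ]x, 2 pi[. *)
Lemma rlaurent_limit_ray (x : R) : rlaurent_limit (\1_`]-oo, x[).
Proof.
have [x0|x0] := leP x 0.
  apply: rlaurent_limit_eq (rlaurent_limit_cst 0) _ => t;
    rewrite /Defs.arc /= in_itv/= => /andP[t0 _].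
  by rewrite indicE memNset//= in_itv/=; apply/negP; rewrite -leNgt (le_trans x0).
have [x1|x1] := ltP (2 * pi) x.
  apply: rlaurent_limit_eq (rlaurent_limit_cst 1) _ => t;
    rewrite /Defs.arc /= in_itv/= => /andP[_ t0].
  by rewrite indicE mem_set//= in_itv/= (le_lt_trans t0).
pose u t := sin (t / 2) * sin ((x - t) / 2) : R.
have lu : rlaurent u.
  have := rlaurentM (rlaurent_cst 2^-1) (rlaurentD (laurent_cos (x / 2)) (rlaurent_cst
    (- cos (x / 2)))).
  congr (rlaurent _); apply/funext => t; rewrite /u.
  have -> : t - x / 2 = t / 2 - (x - t) / 2 by field.
  have -> : x / 2 = t / 2 + (x - t) / 2 by field.
  by rewrite cosB cosD; field.
have u1 t : arc t -> `|u t| <= 1.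
  by move=> _; rewrite normrM mulr_ile1// ?sin_max// ler_norml sin_geN1 sin_le1.
have := rlaurent_limitD (rlaurent_limit_cst 2^-1) (rlaurent_limitZ 2^-1
  (rlaurent_limit_sg lu u1)) => A.
apply: rlaurent_limit_ae A _ _; first by apply: measurable_indic; exact: measurable_itv.
(* at 0, x and 2 pi the sign vanishes and the affine image takes the value 1/2 *)
exists [set 0; x; 2 * pi]; split.
- by do ?apply: measurableU; exact: measurable_set1.
- by apply: countable_lebesgue_measure0; apply: finite_set_countable;
  do ?(rewrite finite_setU; split); exact: finite_set1.
move=> t; apply: contra_notP => tN; rewrite /Defs.arc /= in_itv/= => /andP[t0 t1].
have {}t0 : 0 < t by rewrite lt_neqAle t0 andbT; apply/eqP => E; apply: tN; left; left.
have {}t1 : t < 2 * pi by rewrite lt_neqAle t1 andbT; apply/eqP => E; apply: tN; right.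
have s1 : 0 < sin (t / 2) by apply: sin_gt0_pi; lra.
rewrite /u sgrM (gtr0_sg s1) mul1r indicE.
have [tx|tx|E] := ltgtP t x; last by case: tN; left; right.
- rewrite mem_set /= ?in_itv//= gtr0_sg; first by field.
  by apply: sin_gt0_pi; lra.
- rewrite memNset /= ?in_itv/= -?leNgt ?(ltW tx)//; last by apply/negP;
  rewrite -leNgt ltW.
  rewrite ltr0_sg; first by field.
  rewrite -oppr_gt0 -sinN; apply: sin_gt0_pi; lra.
Qed.

(** * Density of Laurent polynomials in L^2 *)

(** Open rays generate the Borel sets and are stable under intersection, and the
    limits of Laurent polynomials are stable under complements and, by bounded
    convergence, under countable disjoint unions. *)
Lemma rlaurent_limit_indic (A : set R) : measurable A -> rlaurent_limit (\1_A).
Proof.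
move=> mA.
have := @dynkin_induction _ (g_sigma_algebraType (R.-ocitv.-measurable)) (@RGenInftyO.G
  R) (fun A => rlaurent_limit (\1_A)).
apply.
- exact: RGenInftyO.measurableE.
- move=> _ _ [x ->] [y ->]; exists (Num.min x y).
  by apply/seteqP; split=> t /=; rewrite !in_itv/= lt_min => /andP.
- by rewrite indicT; exact: rlaurent_limit_cst.
- by move=> _ [x ->]; exact: rlaurent_limit_ray.
- move=> S mS aS.
  have := rlaurent_limitD (rlaurent_limit_cst 1) (rlaurent_limitZ (-1) aS);
    congr rlaurent_limit.
  apply/funext => t; rewrite indicC indicE; case: (_ \in _) => /=;
    rewrite ?mulr1 ?mulr0; ring.
- move=> F mF tF aF.
  pose U n := \big[setU/set0]_(i < n) F i.
  have aU n : rlaurent_limit (\1_(U n)).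
    elim: n => [|n IH]; first by rewrite /U big_ord0 indic0; exact: rlaurent_limit_cst.
    have := rlaurent_limitD IH (aF n); congr rlaurent_limit; apply/funext => t.
    rewrite /U big_ord_recr/= -/(U n) !indicE in_setU.
    have [tn|] := boolP (t \in F n); last by rewrite orbF addr0.
    rewrite orbT (_ : (t \in U n) = false) ?add0r//; apply/negbTE/negP.
    rewrite inE /U -bigcup_mkord => -[i /= ilt Fit].
    have := tF i n I I; rewrite inE in tn.
    by move=> /(_ (ex_intro _ t (conj Fit tn))) E; move: ilt; rewrite E ltnn.
  apply: (@rlaurent_limit_dominated (fun n => \1_(U n)) _ (fun=> 1)) => //.
  + exact: L2_cst.
  + by move=> n t _; rewrite indicE ger0_norm ?ler0n//; case: (_ \in _) => //=;
    rewrite ?ler01.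
  + move=> t _; apply: cvg_near_cst.
    have [[k _ Fkt]|tN] := pselect ((\bigcup_k F k) t).
      near=> n; rewrite !indicE !mem_set//; first by exists k.
      rewrite /U -bigcup_mkord; exists k => //=; near: n; exact: nbhs_infty_gt.
    apply: nearW => n; rewrite !indicE !memNset// /U -bigcup_mkord => -[k _ Fkt].
    by apply: tN; exists k.
- change ((@RGenInftyO.G R).-sigma.-measurable A).
  by rewrite -RGenInftyO.measurableE.
Unshelve. all: by end_near. Qed.

Lemma rlaurent_limit_sum n (c : nat -> R) (w : nat -> R ->
  R) : (forall i, rlaurent_limit (w i)) ->
  rlaurent_limit (fun t => \sum_(i < n) c i * w i t).
Proof.
move=> aw; elim: n => [|n IH].
  by under eq_fun do rewrite big_ord0; exact: rlaurent_limit_cst.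
by under eq_fun do rewrite big_ord_recr /=;
  apply: rlaurent_limitD IH (rlaurent_limitZ _ (aw n)).
Qed.

Import HBNNSimple.

(** Simple functions increase to u, which serves as its own dominating function. *)
Lemma rlaurent_limit_ge0 (u : R -> R) : (forall t, arc t -> 0 <= u t) ->
  L2 (fun t => (u t)%:C%C) -> rlaurent_limit u.
Proof.
move=> u0 Lu.
have mu_ : measurable_fun arc u := Lu.1.1.
have meu : measurable_fun arc (EFin \o u) by exact/measurable_EFinP.
pose s := nnsfun_approx measurable_arc meu.
have eu0 t : arc t -> (0 <= (EFin \o u) t)%E by move=> /u0; rewrite /= lee_fin.
apply: (@rlaurent_limit_dominated (fun n => (s n : R -> R)) u u) => //.
- move=> n.
  pose e : seq R := finmap.enum_fset (fset_set (s n @` setT)).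
  rewrite (_ : (s n : R -> R) = fun t => \sum_(i < size e) e`_i * \1_(s n @^-1` [set
    e`_i]) t).
    apply: (@rlaurent_limit_sum _ (fun i => e`_i) (fun i => \1_(s n @^-1` [set e`_i])))
      => i.
    exact: rlaurent_limit_indic.
  by apply/funext => t; rewrite fimfunEord.
- move=> n t At; rewrite ger0_norm//.
  by have := @le_approx _ _ _ arc (EFin \o u) n t eu0 At;
    rewrite lee_fin -nnsfun_approxE.
- by move=> t At; have /fine_cvgP[_] := cvg_nnsfun_approx measurable_arc meu eu0 At.
Unshelve. all: by end_near. Qed.

Lemma rlaurent_limit_L2 (u : R -> R) : L2 (fun t => (u t)%:C%C) -> rlaurent_limit u.
Proof.
move=> Lu; have mu_ : measurable_fun arc u := Lu.1.1.
have ap : rlaurent_limit (fun t => Num.max (u t) 0).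
  apply: rlaurent_limit_ge0 => [t _|]; first by rewrite le_max lexx orbT.
  apply: (L2_le Lu); first by apply: cmeasurable_real; apply: measurable_maxr => //;
    exact: measurable_cst.
  move=> t _; rewrite !normc_real; case: (leP (u t) 0) => // _.
  by rewrite expr0n sqr_ge0.
have an : rlaurent_limit (fun t => Num.max (- u t) 0).
  apply: rlaurent_limit_ge0 => [t _|]; first by rewrite le_max lexx orbT.
  apply: (L2_le Lu).
    apply: cmeasurable_real; apply: measurable_maxr; last exact: measurable_cst.
    exact: measurable_funN.
  move=> t _; rewrite !normc_real; case: (leP (- u t) 0) => // _.
    by rewrite expr0n sqr_ge0.
  by rewrite sqrrN.
have := rlaurent_limitD ap (rlaurent_limitZ (-1) an); congr rlaurent_limit;
  apply/funext => t.
case: (leP (u t) 0); case: (leP (- u t) 0); lra.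
Qed.

(** Completeness of the trigonometric system: a real function is the difference
    of its positive and negative parts, a complex one is Re + i Im. *)
Lemma L2_laurent_limit f : L2 f -> laurent_limit f.
Proof.
move=> Lf; have [m1 m2] := Lf.1.
have a1 : rlaurent_limit (fun t => Re (f t)).
  apply: rlaurent_limit_L2; apply: (L2_le Lf); first exact: cmeasurable_real.
  by move=> t _; rewrite normc_real normc_sqE lerDl sqr_ge0.
have a2 : rlaurent_limit (fun t => Im (f t)).
  apply: rlaurent_limit_L2; apply: (L2_le Lf); first exact: cmeasurable_real.
  by move=> t _; rewrite normc_real normc_sqE lerDr sqr_ge0.
have := laurent_limitD a1 (laurent_limitZ 'i%C a2); congr laurent_limit;
  apply/funext => t.
by case: (f t) => a b /=; simpc.
Qed.

(** * Functions of L^2 orthogonal to the powers of z *)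

Lemma Rintegral_arc_FTC (f F : R -> R) : continuous f ->
  (forall x : R, is_derive x (1 : R) F (f x)) ->
    \int[mu]_(t in arc) f t = F (2 * pi) - F 0.
Proof.
move=> cf dF.
have cF : continuous F.
  by move=> x; apply/differentiable_continuous/derivable1_diffP; have [] := dF x.
have p0 : (0 : R) < 2 * pi by rewrite mulr_gt0 ?pi_gt0.
rewrite /Rintegral (@continuous_FTC2 _ f F)//.
- exact: continuous_subspaceT.
- split; [by move=> x _; have [] := dF x|by apply: cvg_at_right_filter;
  exact: cF|by apply: cvg_at_left_filter; exact: cF].
- by move=> x _; rewrite derive1E; have [] := dF x.
Qed.

Lemma zTX (t : R) n : zT t ^+ n = zT (n%:R * t).
Proof.
elim: n => [|n IH]; first by rewrite mul0r /zT cos0 sin0 expr0.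
rewrite exprS IH -natr1 mulrDl mul1r addrC /zT cosD sinD; simpc.
by rewrite [sin t * _ + _]addrC.
Qed.

Lemma cintegral_zX n : cintegral (fun t : R => zT t ^+ n.+1) = 0.
Proof.
pose k : R := n.+1%:R.
have k0 : k != 0 by rewrite pnatr_eq0.
have dk (x : R) : is_derive x 1 (fun t : R => k * t) k.
  by have := is_deriveZ k (is_derive_id x (1 : R)); rewrite /GRing.scale/= mulr1.
have ck : continuous (fun t : R => k * t).
  by move=> x; apply: cvgM; [exact: cvg_cst|exact: cvg_id].
have kE : k * (2 * pi) = 0 + (pi *+ 2) *+ n.+1 by rewrite add0r -[RHS]mulr_natl -[pi *+
  2]mulr_natl.
have sk : sin (k * (2 * pi)) = 0 :> R by rewrite kE (periodicn (@sinD2pi R)) sin0.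
have cK : cos (k * (2 * pi)) = 1 :> R by rewrite kE (periodicn (@cosD2pi R)) cos0.
have Ic : \int[mu]_(t in arc) cos (k * t) = 0.
  have dF (x : R) : is_derive x (1 : R) (fun t => k^-1 * sin (k * t)) (cos (k * x)).
    apply: (is_derive_eq (is_deriveZ k^-1 (is_derive1_comp (is_derive_sin (k * x)) (dk
      x)))).
    by rewrite /GRing.scale/=; field.
  have cc : continuous (fun t : R => cos (k * t)).
    by move=> x; apply: continuous_comp; [exact: ck|exact: continuous_cos].
  by rewrite (Rintegral_arc_FTC cc dF) sk !mulr0 sin0 mulr0 subrr.
have Is : \int[mu]_(t in arc) sin (k * t) = 0.
  have dF (x : R) : is_derive x (1 : R) (fun t => - k^-1 * cos (k * t)) (sin (k * x)).
    apply: (is_derive_eq (is_deriveZ (- k^-1) (is_derive1_comp (is_derive_cos (k * x))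
      (dk x)))).
    by rewrite /GRing.scale/=; field.
  have cc : continuous (fun t : R => sin (k * t)).
    by move=> x; apply: continuous_comp; [exact: ck|exact: continuous_sin].
  by rewrite (Rintegral_arc_FTC cc dF) cK mulr0 cos0 subrr.
rewrite /cintegral; under eq_Rintegral do rewrite zTX /=.
under [X in Complex _ (_ * X)]eq_Rintegral do rewrite zTX /=.
by rewrite Ic Is !mulr0.
Qed.

Lemma sqnorm_fin f : L2 f -> sqnorm f = (\int[mu]_(t in arc) (normc (f t) ^+ 2))%:E.
Proof.
move=> Lf; rewrite /Rintegral fineK//.
exact: (integrable_fin_num _ (L2_sq_integrable Lf)).
Qed.

(** Pythagoras. *)
Lemma sqnorm_sub_orth f g : L2 f -> L2 g -> dot f g = 0 ->
  (sqnorm f <= sqnorm (fun t => f t - g t)%R)%E.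
Proof.
move=> Lf Lg fg; have Lfg := L2B Lf Lg; have Lcg := L2_conj Lg.
have [I _] := L2_mul_integrable Lf Lcg.
have If := L2_sq_integrable Lf; have Ig := L2_sq_integrable Lg.
have R0 : \int[mu]_(t in arc) Re (fmul f (fconj g) t) = 0.
  have := congr1 (@complex.Re R) fg; rewrite /dot /cintegral /= => /eqP.
  by rewrite mulf_eq0 invr_eq0 gt_eqF ?mulr_gt0 ?pi_gt0//= => /eqP.
rewrite !sqnorm_fin// lee_fin.
have -> : \int[mu]_(t in arc) (normc (f t - g t) ^+ 2) =
  \int[mu]_(t in arc) (normc (f t) ^+ 2 + (normc (g t) ^+ 2 + (- 2) * Re (fmul f (fconj
    g) t))).
  apply: eq_Rintegral => t _; rewrite /fmul /fconj !normc_sqE.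
  by case: (f t) (g t) => a b [c d] /=; ring.
have I2 := integrableZl (mu:=mu) measurable_arc (-2) I.
rewrite RintegralD//; last exact: (integrableD (mu:=mu) measurable_arc Ig I2).
rewrite RintegralD// RintegralZl// R0 mulr0 addr0 lerDl.
by apply: Rintegral_ge0 => t _; exact: sqr_ge0.
Qed.

(** Degrees are bounded by the size of q so that the lemma can be used inside an
    induction on the degree. *)
Lemma cintegral_horner f u (q : {poly R[i]}) : L2 f -> Linfty u ->
  (forall n, (n < size q)%N -> cintegral (fun t => f t * u t ^+ n) = 0) ->
  cintegral (fun t => f t * q.[u t]) = 0.
Proof.
move=> Lf Lu; elim/poly_ind: q f Lf => [|p c IH] f Lf H.
  under eq_fun do rewrite horner0 mulr0; exact: cintegral_cst.
have [->|q0] := eqVneq (p * 'X + c%:P) 0.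
  under eq_fun do rewrite horner0 mulr0; exact: cintegral_cst.
have {}H n : (n < (size p).+1)%N -> cintegral (fun t => f t * u t ^+ n) = 0.
  move=> np; apply: H; rewrite size_MXaddC; case: ifP => // /andP[/eqP p0 /eqP c0].
  by move: q0; rewrite p0 c0 mul0r add0r polyC0 eqxx.
have Lfu : L2 (fmul f u).
  by have := L2M_bdd Lu Lf; congr L2; apply/funext => t; rewrite /fmul mulrC.
have Lq := Linfty_horner p Lu.
have -> : (fun t => f t * (p * 'X + c%:P).[u t]) = (fun t => fmul (fmul f u) (fun t =>
  p.[u t]) t + c * f t).
  by apply/funext => t; rewrite /fmul !hornerE; ring.
rewrite cintegralD; last 2 first.
- by apply: L2_mul_integrable Lfu (Linfty_L2 Lq).
- exact: cintegrableZ (L2_integrable Lf).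
rewrite cintegralZ; last exact: L2_integrable.
rewrite /fmul IH// ?add0r; last first.
  by move=> n np; rewrite -[RHS](H n.+1 np); congr cintegral; apply/funext => t;
    rewrite exprS; ring.
by have := H 0%N isT; under eq_fun do rewrite expr0 mulr1; move=> ->; rewrite mulr0.
Qed.

Lemma H2P f : H2 f <-> L2 f /\ forall n, cintegral (fun t => f t * zT t ^+ n.+1) = 0.
Proof.
rewrite /H2 /= /dot.
have E n : fmul f (fconj (fun t => conjc (zT t) ^+ n.+1)) = (fun t => f t * zT t ^+
  n.+1).
  by apply/funext => t; rewrite /fmul /fconj conjcX conjcK.
by split => -[Lf H]; split => // n; [rewrite -E|rewrite E].
Qed.

(** Analytic part plus strictly antianalytic part. *)
Lemma laurent_split p : laurent p -> exists q1 q2 : {poly R[i]},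
  forall t, p t = q1.[zT t] + conjc (zT t) * q2.[conjc (zT t)].
Proof.
move=> [N [q pE]]; elim: N q p pE => [|N IH] q p pE.
  by exists q, 0 => t; rewrite pE horner0 mulr0 addr0 mul1r.
have [|q1 [q2 E]] := IH q (fun t => conjc (zT t) ^+ N * q.[zT t]); first by [].
have [q1' [c q1E]] : exists q1' c, q1 = q1' * 'X + c%:P.
  elim/poly_ind: q1 {E} => [|q1' c _]; last by exists q1', c.
  by exists 0, 0; rewrite mul0r addr0.
exists q1', ('X * q2 + c%:P) => t.
rewrite pE exprS -mulrA E q1E !hornerE.
transitivity (q1'.[zT t] * (conjc (zT t) * zT t) +
  conjc (zT t) * (conjc (zT t) * q2.[conjc (zT t)] + c));
    last by rewrite conjc_zT_mul mulr1.
by ring.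
Qed.

Lemma H2_zX n : H2 (fun t : R => zT t ^+ n).
Proof.
apply/H2P; split; first exact: Linfty_L2 (LinftyX n Linfty_z).
by move=> m; under eq_fun do rewrite -exprD addnS; exact: cintegral_zX.
Qed.

Lemma H2_poly (q : {poly R[i]}) : H2 (fun t => q.[zT t]).
Proof.
apply/H2P; split; first exact: Linfty_L2 (Linfty_horner _ Linfty_z).
move=> n.
rewrite (_ : (fun t => _) = (fun t => zT t ^+ n.+1 * q.[zT t])); last first.
  by apply/funext => t; rewrite mulrC.
apply: (@cintegral_horner (fun t => zT t ^+ n.+1) (@zT R) q (Linfty_L2 (LinftyX _
  Linfty_z)) Linfty_z) => m _.
under eq_fun do rewrite -exprD addSn; exact: cintegral_zX.
Qed.

(** Approximate h by a Laurent polynomial with analytic part q1 and antianalytic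
    part r. Both h and q1 are orthogonal to r, so by Pythagoras q1 is at least as
    close to h; and f does not see q1. *)
Lemma orth_zX_H2 f h : L2 f -> (forall n, cintegral (fun t => f t * conjc (zT t) ^+ n)
  = 0) ->
  H2 h -> dot f h = 0.
Proof.
move=> Lf fz /H2P[Lh hz]; apply: (cintegral_small Lf) => e e0.
have [_ /(_ _ e0)[p [lp hp]]] := L2_laurent_limit Lh.
have [q1 [q2 pE]] := laurent_split lp.
have Lz := Linfty_z.
have Lq1 := Linfty_horner q1 Lz.
pose r t := conjc (zT t) * q2.[conjc (zT t)].
have Lr : L2 r.
  by apply: Linfty_L2; apply: LinftyM (Linfty_conj Lz) _;
    exact: Linfty_horner (Linfty_conj Lz).
have Lhq := L2B Lh (Linfty_L2 Lq1).
have orth g : H2 g -> dot g r = 0.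
  move=> /H2P[Lg gz].
  pose q3 := map_poly conjc q2.
  have rE t : conjc (r t) = zT t * q3.[zT t].
    by rewrite /r conjcM conjcK /q3 -[zT t in RHS]conjcK horner_map conjcK.
  rewrite /dot (_ : fmul _ _ = (fun t => fmul (@zT R) g t * q3.[zT t])); last first.
    by apply/funext => t; rewrite /fmul /fconj rE; ring.
  apply: (@cintegral_horner (fmul (@zT R) g) (@zT R) q3 (L2M_bdd Lz Lg) Lz) => n _.
  rewrite -[RHS](gz n); congr cintegral; apply/funext => t.
  by rewrite /fmul exprS; ring.
(* the pairing of f with the conjugate of h - q1 is dot f h *)
exists (fconj (fun t => h t - q1.[zT t])); split; first exact: L2_conj.
- rewrite sqnorm_conj; apply: le_lt_trans hp.
  rewrite (_ : (fun t => h t - p t) = (fun t => (h t - q1.[zT t]) - r t)); last first.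
    by apply/funext => t; rewrite pE /r; ring.
  apply: sqnorm_sub_orth => //; rewrite /dot.
  rewrite (_ : fmul _ _ = (fun t => fmul h (fconj r) t - fmul (fun t => q1.[zT t])
    (fconj r) t)); last first.
    by apply/funext => t; rewrite /fmul; ring.
  rewrite cintegralB; last 2 first.
  - exact: L2_mul_integrable Lh (L2_conj Lr).
  - exact: L2_mul_integrable (Linfty_L2 Lq1) (L2_conj Lr).
  have := orth _ (H2_poly q1); have := orth h; rewrite /dot => -> ; last exact/H2P.
  by move=> ->; rewrite subrr.
- rewrite /dot (_ : fmul _ _ = (fun t => fmul f (fconj h) t - f t * (map_poly conjc
  q1).[conjc (zT t)])); last first.
    by apply/funext => t; rewrite /fmul /fconj conjcB horner_map; ring.
  rewrite cintegralB; last 2 first.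
  - exact: L2_mul_integrable Lf (L2_conj Lh).
  - by apply: L2_mul_integrable Lf (Linfty_L2 _); exact: Linfty_horner (Linfty_conj Lz).
  by rewrite (cintegral_horner Lf (Linfty_conj Lz) (fun n _ => fz n)) subr0.
Qed.

(** * The space H^2 and its orthogonal complement *)

Lemma aeq_sym f g : aeq f g -> aeq g f.
Proof. by apply: ae_imp => t ->. Qed.

Lemma aeq_fun f g : (forall t, f t = g t) -> aeq f g.
Proof. by move=> fg; apply: aeW => t _. Qed.

Lemma cintegral_mul_aeq f g : L2 f -> L2 g -> forall h, L2 h -> aeq f g ->
  cintegral (fmul f h) = cintegral (fmul g h).
Proof.
move=> Lf Lg h Lh fg; apply: cintegral_ae;
  [exact: cmeasurableM Lf.1 Lh.1|exact: cmeasurableM Lg.1 Lh.1|].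
by move: fg; apply: ae_imp => t; rewrite /fmul => ->.
Qed.

Lemma dot_sym f g : L2 f -> L2 g -> dot g f = conjc (dot f g).
Proof.
move=> Lf Lg; rewrite /dot -cintegral_conj;
  last exact: L2_mul_integrable Lf (L2_conj Lg).
by congr cintegral; apply/funext => t; rewrite /fmul /fconj conjcM conjcK mulrC.
Qed.

Lemma dot_aeql f g h : L2 f -> L2 g -> L2 h -> aeq f g -> dot f h = dot g h.
Proof. by move=> Lf Lg Lh; exact: cintegral_mul_aeq Lf Lg _ (L2_conj Lh). Qed.

Lemma dot_aeqr f g h : L2 f -> L2 g -> L2 h -> aeq f g -> dot h f = dot h g.
Proof. by move=> Lf Lg Lh fg; rewrite (dot_sym Lf Lh) (dot_sym Lg Lh) (dot_aeql Lf Lg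
  Lh fg). Qed.

Lemma dotBr f g h : L2 f -> L2 g -> L2 h ->
  dot h (fun t => f t - g t) = dot h f - dot h g.
Proof.
move=> Lf Lg Lh; rewrite /dot -cintegralB; try exact: L2_mul_integrable Lh (L2_conj _).
by congr cintegral; apply/funext => t; rewrite /fmul /fconj conjcB; ring.
Qed.

Lemma H2_ae f g : H2 f -> cmeasurable g -> aeq f g -> H2 g.
Proof.
move=> /H2P[Lf fz] mg fg; have Lg := L2_ae Lf mg fg; apply/H2P; split => // n.
by rewrite -[RHS](fz n); symmetry; apply: cintegral_mul_aeq => //; apply: Linfty_L2;
  apply: LinftyX; exact: Linfty_z.
Qed.

Lemma H2B f g : H2 f -> H2 g -> H2 (fun t => f t - g t).
Proof.
move=> /H2P[Lf fz] /H2P[Lg gz]; apply/H2P; split; first exact: L2B.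
move=> n; have LX := Linfty_L2 (LinftyX n.+1 Linfty_z).
have := cintegralB (L2_mul_integrable Lf LX) (L2_mul_integrable Lg LX);
  rewrite /fmul fz gz subr0 => <-.
by congr cintegral; apply/funext => t; ring.
Qed.

(** The conjugate of z g is orthogonal to all z^n, n >= 0. *)
Lemma H2_pairing g h : H2 g -> H2 h -> cintegral (fun t => zT t * g t * h t) = 0.
Proof.
move=> /H2P[Lg gz] Hh.
have Lzg := L2M_bdd Linfty_z Lg.
have E0 : dot (fconj (fmul z g)) h = 0.
  apply: orth_zX_H2 => //; first exact: L2_conj.
  move=> n; rewrite -[RHS]conjc0 -(gz n) -cintegral_conj; last first.
    exact: L2_mul_integrable Lg (Linfty_L2 (LinftyX n.+1 Linfty_z)).
  by congr cintegral; apply/funext => t; rewrite /fmul /fconj !conjcM conjcX exprS;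
    ring.
rewrite -[RHS]conjc0 -E0 /dot -cintegral_conj; last first.
  by apply: L2_mul_integrable; apply: L2_conj => //; exact: Hh.1.
by congr cintegral; apply/funext => t; rewrite /fmul /fconj !conjcM !conjcK.
Qed.

(** H^infty H^2 lies in H^2, since the Fourier coefficient of index -(n+1) of u h
    is the pairing of z (u z^n) with h. *)
Lemma H2M u h : H2 u -> Linfty u -> H2 h -> H2 (fmul u h).
Proof.
move=> /H2P[Lu uz] bu Hh; apply/H2P; split; first exact: L2M_bdd bu Hh.1.
move=> n.
have Huz : H2 (fun t => u t * zT t ^+ n).
  apply/H2P; split.
    exact: L2M_bdd bu (Linfty_L2 (LinftyX n Linfty_z)).
  by move=> m; under eq_fun do rewrite -mulrA -exprD addnS; exact: uz.
rewrite -[RHS](H2_pairing Huz Hh); congr cintegral; apply/funext => t.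
by rewrite /fmul exprS; ring.
Qed.

Definition H2minus := ominus (@L2 R) (@H2 R).

Lemma H2minusP f : H2minus f <-> L2 f /\ forall n, cintegral (fun t => f t * conjc (zT
  t) ^+ n) = 0.
Proof.
split=> -[Lf H]; split => //.
  move=> n; have := H _ (H2_poly 'X^n); rewrite /dot => E; rewrite -[RHS]E.
  by congr cintegral; apply/funext => t; rewrite /fmul /fconj hornerXn conjcX.
by move=> h Hh; exact: orth_zX_H2.
Qed.

(** Multiplication by z followed by conjugation exchanges H2minus and H^2. *)
Lemma H2minus_conj f : H2minus f <-> cmeasurable f /\ H2 (fconj (fmul z f)).
Proof.
have E n : L2 f -> cintegral (fun t => fconj (fmul z f) t * zT t ^+ n.+1) =
   conjc (cintegral (fun t => f t * conjc (zT t) ^+ n)).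
  move=> Lf; rewrite -cintegral_conj; last first.
    exact: L2_mul_integrable Lf (Linfty_L2 (LinftyX n (Linfty_conj Linfty_z))).
  congr cintegral; apply/funext => t; rewrite /fmul /fconj !conjcM conjcX conjcK exprS.
  by rewrite -[RHS]mul1r -(conjc_zT_mul t); ring.
split.
  move=> /H2minusP[Lf fz]; split; first exact: Lf.1.
  apply/H2P; split; first exact/L2_conj/L2M_bdd/Lf/Linfty_z.
  by move=> n; rewrite E// fz conjc0.
move=> [mf /H2P[Lzf fz]].
have Lf : L2 f.
  have := L2M_bdd (Linfty_conj Linfty_z) (L2_conj Lzf); congr L2.
  by apply/funext => t; rewrite /fmul /fconj conjcK mulrA conjc_zT_mul mul1r.
apply/H2minusP; split => // n.
by apply: (can_inj (@conjcK R)); rewrite -E// fz conjc0.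
Qed.

(** * Model spaces and the kernel of the operator *)

Definition unimodular u := Linfty u /\ {ae mu, forall t, arc t -> normc (u t) = 1}.

Lemma dot_unimodular u f g : unimodular u -> L2 f -> L2 g ->
  dot (fmul u f) (fmul u g) = dot f g.
Proof.
move=> [bu u1] Lf Lg; apply: cintegral_ae.
- exact: (cmeasurableM (cmeasurableM bu.1 Lf.1) (cmeasurable_conj (cmeasurableM bu.1
  Lg.1))).
- exact: (cmeasurableM Lf.1 (cmeasurable_conj Lg.1)).
move: u1; apply: ae_imp => t /conjc_mul_unit ut.
by rewrite /fmul /fconj conjcM -[RHS]mul1r -ut; ring.
Qed.

Lemma unimodular_inner u : inner u -> unimodular u.
Proof. by move=> [[_ bu] u1]; split. Qed.

Lemma unimodular_zM u : unimodular u -> unimodular (fmul z u).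
Proof.
move=> [bu u1]; split; first exact: LinftyM Linfty_z bu.
by move: u1; apply: ae_imp => t ut; rewrite /fmul normcM ut normc_zT mulr1.
Qed.

Lemma KspaceP u f : Linfty u ->
  Kspace u f <-> H2 f /\ forall h, H2 h -> dot f (fmul u h) = 0.
Proof.
move=> bu; split=> -[Hf H]; split=> //.
  move=> h Hh; apply: H; split; first exact: cmeasurableM bu.1 Hh.1.1.
  by exists h => //; exact: aeq_fun.
move=> g [mg [h Hh gE]].
have Luh := L2M_bdd bu Hh.1.
rewrite (dot_aeqr _ Luh Hf.1 gE); first exact: H.
exact: L2_ae Luh mg (aeq_sym gE).
Qed.

Lemma Kspace_ae u f g : Linfty u -> Kspace u f -> cmeasurable g -> aeq f g ->
  Kspace u g.
Proof.
move=> bu /KspaceP-/(_ bu)[Hf H] mg fg; apply/KspaceP => //.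
have Hg := H2_ae Hf mg fg; split=> // h Hh.
rewrite -(dot_aeql Hf.1 Hg.1 (L2M_bdd bu Hh.1) fg); exact: H.
Qed.

Lemma Kperp_H2minus u f : H2minus f -> Kperp u f.
Proof. by move=> [Lf H]; split => // g [Hg _]; exact: H. Qed.

Lemma Kperp_mulH2 u h : Linfty u -> H2 h -> Kperp u (fmul u h).
Proof.
move=> bu Hh; have Luh := L2M_bdd bu Hh.1; split=> // g /KspaceP-/(_ bu)[Hg Kg].
by rewrite (dot_sym Hg.1 Luh) Kg// conjc0.
Qed.

Lemma cintegral_conjzX n : cintegral (fun t : R => conjc (zT t) ^+ n.+1) = 0.
Proof.
rewrite -[RHS]conjc0 -(cintegral_zX n) -cintegral_conj; last first.
  exact: L2_integrable (Linfty_L2 (LinftyX _ Linfty_z)).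
by congr cintegral; apply/funext => t; rewrite /fconj conjcX.
Qed.

Lemma H2minus_conjzX n : H2minus (fun t : R => conjc (zT t) ^+ n.+1).
Proof.
apply/H2minusP; split.
  exact: Linfty_L2 (LinftyX n.+1 (Linfty_conj Linfty_z)).
move=> m; rewrite -[RHS](cintegral_conjzX (n + m)).
by congr cintegral; apply/funext => t; rewrite -exprD addSn.
Qed.

(** The negative powers of z witness that G f is in H^2, and theta H^2 that it is
    orthogonal to theta H^2; both families lie in K_theta^perp. *)
Lemma kerDP theta G f : Linfty theta -> Linfty G ->
  kerD theta G f <-> Kperp theta f /\ Kspace theta (fmul G f).
Proof.
move=> bt bG; split.
  move=> [Kf [_ orth]]; split => //; have LGf := L2M_bdd bG Kf.1.
  have {}orth h : Kperp theta h -> dot (fmul G f) h = 0.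
    by move=> /orth; rewrite (_ : (fun t => _) = fmul G f)//; apply/funext => t;
      rewrite subr0.
  apply/KspaceP => //; split; first split=> // n.
    by apply: orth; apply: Kperp_H2minus; exact: H2minus_conjzX.
  by move=> h Hh; apply: orth; exact: Kperp_mulH2.
move=> [Kf KGf]; split=> //; split.
  split; first exact: L2_cst.
  move=> g _; rewrite /dot (_ : fmul _ _ = fun=> 0); first exact: cintegral_cst.
  by apply/funext => t; rewrite /fmul mul0r.
move=> h Kh; rewrite (_ : (fun t => _) = fmul G f); last by apply/funext => t;
  rewrite subr0.
by rewrite (dot_sym Kh.1 KGf.1.1) Kh.2// conjc0.
Qed.

Lemma kerD_conjz theta G : Linfty theta -> Linfty G ->
  kerD theta G (fconj z) <-> (smul z (Kspace theta) `&` Linfty) G.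
Proof.
move=> bt bG.
have bz := Linfty_z; have Gz : cmeasurable (fmul G (fconj z)).
  exact: cmeasurableM bG.1 (cmeasurable_conj bz.1).
split.
  move=> /kerDP-/(_ bt bG)[_ K]; split=> //; split; first exact: bG.1.
  exists (fmul G (fconj z)) => //; apply: aeq_fun => t.
  by rewrite /fmul /fconj -[LHS]mulr1 -(conjc_zT_mul t); ring.
move=> [[_ [g Kg GE]] _]; apply/kerDP => //; split.
  by apply: Kperp_H2minus; have := H2minus_conjzX 0; congr H2minus.
apply: (Kspace_ae bt Kg Gz); move: GE; apply: ae_imp => t.
by rewrite /fmul /fconj => ->; rewrite -[LHS]mul1r -(conjc_zT_mul t); ring.
Qed.

Lemma smul_z_Kspace_Hinfty theta :
  smul z (Kspace theta) `&` Linfty `<=` smul z (@Hinfty R).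
Proof.
move=> G [[mG [g [Hg _] GE]] bG]; split=> //; exists g => //; split=> //.
apply: (Linfty_ae (LinftyM (Linfty_conj Linfty_z) bG) Hg.1.1).
move: GE; apply: ae_imp => t.
by rewrite /fmul /fconj => ->; rewrite mulrA conjc_zT_mul mul1r.
Qed.

(** * Outer functions *)

Lemma H2_cst1 : H2 (fun _ : R => 1).
Proof. by have := H2_poly (1%:P : {poly R[i]}); congr H2; apply/funext => t;
  rewrite hornerC. Qed.

Lemma outer_approx g : outer g -> forall e : R, 0 < e ->
  exists p : {poly R[i]}, (sqnorm (fun t => (1 - p.[zT t] * g t)%R) < e%:E)%E.
Proof. by move=> [_ H] e e0; exact: H _ H2_cst1 _ e0. Qed.

Lemma L2_polyM (p : {poly R[i]}) f : L2 f -> L2 (fun t => p.[zT t] * f t).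
Proof. exact: L2M_bdd (Linfty_horner p Linfty_z). Qed.

(** The constant 1 is a limit of p(z) g, whose mean p(0) (mean of g) would vanish
    with the mean of g. *)
Lemma outer_mean g : outer g -> cintegral g != 0.
Proof.
move=> og; have [/H2P[Lg gz] _] := og; apply/eqP => g0.
suff /eqP : (1 : R[i]) = 0 by rewrite oner_eq0.
apply: (cintegral_small (L2_cst (1 : R[i]))) => e e0.
have [p pe] := outer_approx og e0.
exists (fun t => 1 - p.[zT t] * g t); split=> //.
  exact: L2B (L2_cst 1) (L2_polyM p Lg).
rewrite (_ : fmul _ _ = (fun t => 1 - g t * p.[zT t])); last first.
  by apply/funext => t; rewrite /fmul mul1r mulrC.
rewrite cintegralB ?cintegral_cst; last 2 first.
- exact: L2_integrable (L2_cst 1).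
- exact: L2_mul_integrable Lg (Linfty_L2 (Linfty_horner p Linfty_z)).
rewrite (cintegral_horner Lg Linfty_z) ?subr0// => -[|n] _ //.
by under eq_fun do rewrite expr0 mulr1.
Qed.

(** In the Fourier coefficient of h replace h by h p(z) g, which is in H^2, at the
    cost of an error of the size of 1 - p(z) g. *)
Lemma outer_div g h : outer g -> L2 h -> H2 (fmul h g) -> H2 h.
Proof.
move=> og Lh Hhg; have [Hg _] := og; apply/H2P; split=> // n.
have LX := LinftyX n.+1 Linfty_z.
have LhX : L2 (fmul (fun t => zT t ^+ n.+1) h) by exact: L2M_bdd.
apply: (cintegral_small LhX) => e e0.
have [p pe] := outer_approx og e0.
exists (fun t => 1 - p.[zT t] * g t); split=> //.
  exact: L2B (L2_cst 1) (L2_polyM p Hg.1).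
have /H2P[Lph phz] := H2M (H2_poly p) (Linfty_horner p Linfty_z) Hhg.
rewrite (_ : fmul _ _ = (fun t => h t * zT t ^+ n.+1 -
    fmul (fun t => p.[zT t]) (fmul h g) t * zT t ^+ n.+1)); last first.
  by apply/funext => t; rewrite /fmul; ring.
by rewrite (cintegralB (L2_mul_integrable Lh (Linfty_L2 LX)) (L2_mul_integrable Lph
  (Linfty_L2 LX))) phz subr0.
Qed.

(** * Splitting off the analytic part *)

(** Removing the mean is enough once the coefficients of positive index vanish. *)
Lemma H2minus_sub_mean f : L2 f ->
  (forall n, cintegral (fun t => f t * conjc (zT t) ^+ n.+1) = 0) ->
  H2minus (fun t => f t - cintegral f).
Proof.
move=> Lf fz; set d := cintegral f.
apply/H2minusP; split; first exact: L2B Lf (L2_cst d).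
move=> m; have LX := Linfty_L2 (LinftyX m (Linfty_conj Linfty_z)).
rewrite (_ : (fun t => _) = (fun t => fmul f (fun t => conjc (zT t) ^+ m) t
     - d * conjc (zT t) ^+ m)); last by apply/funext => t; rewrite /fmul; ring.
rewrite cintegralB; last 2 first.
- exact: L2_mul_integrable Lf LX.
- exact: cintegrableZ (L2_integrable LX).
rewrite cintegralZ; last exact: L2_integrable.
case: m {LX} => [|m]; last by rewrite fz cintegral_conjzX mulr0 subrr.
rewrite (_ : fmul _ _ = f); last by apply/funext => t; rewrite /fmul expr0 mulr1.
under [X in _ - _ * cintegral X]eq_fun do rewrite expr0.
by rewrite cintegral_cst mulr1 subrr.
Qed.

(** The coanalytic Toeplitz operator of symbol conj u is upper triangular on
    polynomials, with the conjugate of the mean of u on the diagonal. *)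
Lemma conj_mulX_split u n : H2 u -> Linfty u -> exists p : {poly R[i]},
  (size p <= n)%N /\
  H2minus (fun t => conjc (u t) * zT t ^+ n -
                    (conjc (cintegral u) * zT t ^+ n + p.[zT t])).
Proof.
move=> /H2P[Lu uz] bu; set c := conjc (cintegral u).
have bz := Linfty_z.
elim: n => [|n [p [sp Hr]]].
  exists 0; split; first by rewrite size_poly0.
  have -> : (fun t => conjc (u t) * zT t ^+ 0 - (c * zT t ^+ 0 + 0.[zT t])) =
      (fun t => fconj u t - cintegral (fconj u)).
    apply/funext => t; rewrite cintegral_conj ?expr0 ?horner0 ?addr0 ?mulr1//.
    exact: L2_integrable.
  apply: H2minus_sub_mean => [|m]; first exact: L2_conj.
  rewrite -[RHS]conjc0 -(uz m) -cintegral_conj; last first.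
    exact: L2_mul_integrable Lu (Linfty_L2 (LinftyX m.+1 bz)).
  by congr cintegral; apply/funext => t; rewrite /fconj conjcM conjcX.
(* multiplying the remainder by z creates at most a constant term *)
set r := (fun t => _) in Hr; have /H2minusP[Lr rz] := Hr.
pose d := cintegral (fmul z r); exists (p * 'X + d%:P); split.
  by rewrite size_MXaddC; case: ifP.
rewrite (_ : (fun t => _) = (fun t => fmul z r t - d)); last first.
  by apply/funext => t; rewrite /fmul /r hornerMXaddC exprS; cbv beta; ring.
apply: H2minus_sub_mean => [|m]; first exact: L2M_bdd.
rewrite -[RHS](rz m); congr cintegral; apply/funext => t.
by rewrite /fmul exprS -[RHS]mul1r -(conjc_zT_mul t); ring.
Qed.

(** theta r is orthogonal to theta H^2 whenever r is orthogonal to H^2, theta being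
    isometric. *)
Lemma Kspace_mul_H2minus u r : unimodular u -> H2minus r -> H2 (fmul u r) ->
  Kspace u (fmul u r).
Proof.
move=> uu [Lr rz] Hur; apply/KspaceP; first exact: uu.1.
by split=> // h Hh; rewrite dot_unimodular//; [exact: rz|exact: Hh.1].
Qed.

Lemma dot_mul_horner f u (q : {poly R[i]}) : L2 f -> Linfty u ->
  (forall j, (j < size q)%N -> dot f (fun t => u t * zT t ^+ j) = 0) ->
  dot f (fun t => u t * q.[zT t]) = 0.
Proof.
move=> Lf bu H; pose q' := map_poly conjc q.
have Lfu : L2 (fmul (fconj u) f) by exact: L2M_bdd (Linfty_conj bu) Lf.
have := @cintegral_horner _ _ q' Lfu (Linfty_conj Linfty_z).
rewrite size_map_poly /dot => E; rewrite -[RHS]E; last first.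
  move=> n nq; rewrite -[RHS](H n nq); congr cintegral; apply/funext => t.
  by rewrite /fmul /fconj conjcM conjcX; ring.
congr cintegral; apply/funext => t.
by rewrite /fmul /fconj conjcM /q' horner_map; ring.
Qed.

(** * The kernel in the presence of an inner-outer factorization *)

(** Multiplication by z v carries f to an element of K_(z v); orthogonality to
    z v H^2 then reads as orthogonality of f to H^2. *)
Lemma mem_conj_Kspace v f : unimodular v ->
  (smul (fconj z) (smul (fconj v) (Kspace (fmul z v)))) f <->
  H2minus f /\ H2 (fmul (fmul z v) f).
Proof.
move=> uv; have uzv := unimodular_zM uv; have bz := Linfty_z.
set w := fmul z v in uzv *; split.
  move=> [mf [g [mg [k /KspaceP-/(_ uzv.1)[Hk Kk] gE]] fE]].
  have fE' : aeq (fmul w f) k.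
    move: (uv.2) (ae_imp2 (fun t => @conj _ _) fE gE);
      apply: ae_imp2 => t /conjc_mul_unit vt [].
    rewrite /w /fmul /fconj => -> ->;
      rewrite -[RHS]mul1r -vt -[RHS]mul1r -(conjc_zT_mul t).
    by ring.
  have Hwf := H2_ae Hk (cmeasurableM uzv.1.1 mf) (aeq_sym fE').
  have Lf : L2 f.
    apply: (L2_ae (L2M_bdd (Linfty_conj uzv.1) Hwf.1) mf).
    move: uzv.2; apply: ae_imp => t /conjc_mul_unit wt.
    by rewrite /fmul /fconj mulrA wt mul1r.
  split=> //; split=> // h Hh; rewrite -(dot_unimodular uzv Lf Hh.1).
  rewrite (dot_aeql Hwf.1 Hk.1 (L2M_bdd uzv.1 Hh.1) fE'); exact: Kk.
move=> [Hf Hwf]; have mf := Hf.1.1; split=> //.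
exists (fmul (fconj v) (fmul w f)); last first.
  move: uv.2; apply: ae_imp => t /conjc_mul_unit vt.
  by rewrite /w /fmul /fconj -[LHS]mul1r -vt -[LHS]mul1r -(conjc_zT_mul t); ring.
split; first exact: cmeasurableM (cmeasurable_conj uv.1.1) Hwf.1.1.
exists (fmul w f); last exact: aeq_fun.
apply/KspaceP; first exact: uzv.1.
by split=> // h Hh; rewrite dot_unimodular//; [exact: Hf.2|exact: Hf.1|exact: Hh.1].
Qed.

(** Here conj (z f) is the element of K_(z v): its membership in H^2 says that f is
    in H2minus, and its orthogonality to z v H^2 says that z v f is in H^2. *)
Lemma mem_sconj_Kspace v f : unimodular v ->
  (smul (fconj z) (sconj (Kspace (fmul z v)))) f <->
  H2minus f /\ H2 (fmul (fmul z v) f).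
Proof.
move=> uv; have uzv := unimodular_zM uv; have bz := Linfty_z.
have bw := uzv.1; set w := fmul z v in uzv bw *; split.
  move=> [mf [_ [k /KspaceP-/(_ bw)[Hk Kk] <-] fE]].
  have kE : aeq k (fconj (fmul z f)).
    move: fE; apply: ae_imp => t; rewrite /fmul /fconj => ->.
    by rewrite !conjcM !conjcK mulrA conjc_zT_mul mul1r.
  have mc : cmeasurable (fconj (fmul z f)) := cmeasurable_conj (cmeasurableM bz.1 mf).
  have Hf : H2minus f by apply/H2minus_conj; split=> //; exact: H2_ae Hk mc kE.
  split=> //; have Lf := Hf.1; apply/H2P; split; first exact: L2M_bdd.
  move=> n; have LX := LinftyX n bz.
  have Hp := H2_zX n.
  have LwX : L2 (fmul w (fun t => zT t ^+ n)) := Linfty_L2 (LinftyM bw LX).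
  rewrite -[RHS]conjc0 -(Kk _ Hp) (dot_aeql Hk.1 (L2_conj (L2M_bdd bz Lf)) LwX kE).
  rewrite /dot -cintegral_conj; last exact: L2_mul_integrable (L2_conj (L2M_bdd bz Lf))
    (L2_conj LwX).
  congr cintegral; apply/funext => t.
  by rewrite /w /fmul /fconj !conjcM !conjcK exprS; ring.
move=> [Hf Hwf]; have Lf := Hf.1; have mf := Lf.1; split=> //.
exists (fmul z f); last first.
  by apply: aeq_fun => t; rewrite /fmul /fconj mulrA conjc_zT_mul mul1r.
exists (fconj (fmul z f)); last by apply/funext => t; rewrite /fconj conjcK.
have [_ Hc] := (H2minus_conj f).1 Hf.
apply/KspaceP => //; split=> // h Hh.
have := H2_pairing Hwf Hh => E.
rewrite -[RHS]conjc0 -E /dot -cintegral_conj; last first.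
  exact: L2_mul_integrable (L2M_bdd bz (L2M_bdd bw Lf)) Hh.1.
congr cintegral; apply/funext => t.
by rewrite /fmul /fconj !conjcM; ring.
Qed.

(** theta conj G is the image of G conj z under the conjugation
    f |-> theta conj (z f) of K_theta. *)
Lemma H2_theta_conj theta G : Linfty theta -> Linfty G ->
  Kspace theta (fmul G (fconj z)) -> H2 (fmul theta (fconj G)).
Proof.
move=> bt bG /KspaceP-/(_ bt)[HG KG]; have bz := Linfty_z.
apply/H2P; split; first exact: Linfty_L2 (LinftyM bt (Linfty_conj bG)).
move=> n; have LX := LinftyX n bz.
have Hp := H2_zX n.
rewrite -[RHS]conjc0 -(KG _ Hp) /dot -cintegral_conj; last first.
  exact: L2_mul_integrable HG.1 (L2_conj (Linfty_L2 (LinftyM bt LX))).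
by congr cintegral; apply/funext => t; rewrite /fmul /fconj !conjcM !conjcK exprS; ring.
Qed.

Lemma dot_mul_theta theta G f h :
  dot (fmul G f) (fmul theta h) = dot f (fmul (fmul theta (fconj G)) h).
Proof.
by congr cintegral; apply/funext => t; rewrite /fmul /fconj !conjcM conjcK; ring.
Qed.

Lemma Linfty_outer_factor v G g : unimodular v -> cmeasurable g -> Linfty G ->
  aeq G (fmul z (fmul v g)) -> Linfty g.
Proof.
move=> uv mg bG GE.
apply: (Linfty_ae (LinftyM (Linfty_conj (unimodular_zM uv).1) bG) mg).
move: uv.2 GE; apply: ae_imp2 => t /conjc_mul_unit vt;
  rewrite /fmul /fconj conjcM => ->.
by rewrite -[RHS]mul1r -vt -[RHS]mul1r -(conjc_zT_mul t); ring.
Qed.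

(** By the splitting of conj theta z^n, each z^n is a polynomial multiple of theta
    plus some theta r in K_theta; so f is orthogonal to every z^n. *)
Lemma Kperp_orth_theta_zX theta f : unimodular theta -> H2 theta -> Kperp theta f ->
  (forall n, dot f (fun t => theta t * zT t ^+ n) = 0) -> H2minus f.
Proof.
move=> ut Ht Kf fX; have bt := ut.1; have Lf := Kf.1.
have theta_poly (q : {poly R[i]}) : dot f (fun t => theta t * q.[zT t]) = 0.
  by apply: dot_mul_horner.
apply/H2minusP; split=> // n.
suff : dot f (fun t => zT t ^+ n) = 0.
  by move=> E; rewrite -[RHS]E; congr cintegral; apply/funext => t;
    rewrite /fmul /fconj conjcX.
have [p [_ Hr]] := conj_mulX_split n Ht bt.
set c := conjc (cintegral theta) in Hr; set r := (fun t => _) in Hr.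
pose q := c *: 'X^n + p.
have Htq : H2 (fun t => theta t * q.[zT t]) := H2M Ht bt (H2_poly q).
have tr : aeq (fun t => zT t ^+ n - theta t * q.[zT t]) (fmul theta r).
  move: ut.2; apply: ae_imp => t /conjc_mul_unit tt;
    rewrite /r /fmul /q hornerD hornerZ hornerXn.
  by rewrite -[zT t ^+ n in LHS]mul1r -{1}tt; ring.
have Hdiff := H2B (H2_zX n) Htq.
have Htr : H2 (fmul theta r) := H2_ae Hdiff (cmeasurableM bt.1 Hr.1.1) tr.
have fr : dot f (fmul theta r) = 0 by exact: Kf.2 _ (Kspace_mul_H2minus ut Hr Htr).
have := dotBr (H2_zX n).1 Htq.1 Lf;
  rewrite (dot_aeqr Hdiff.1 Htr.1 Lf tr) fr theta_poly subr0.
by move=> <-.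
Qed.

(** With k = theta conj G the function f is orthogonal to k H^2 and to K_theta; the
    splitting of conj g z^n then yields f orthogonal to theta z^n by induction
    on n. *)
Lemma kerD_sub_H2minus theta G v g f : unimodular theta -> H2 theta -> Linfty G ->
  inner v -> outer g -> aeq G (fmul z (fmul v g)) ->
  Kspace theta (fmul G (fconj z)) -> Kperp theta f -> Kspace theta (fmul G f) ->
  H2minus f.
Proof.
move=> ut Ht bG iv og GE KGz Kf KGf.
have bt := ut.1; have bz := Linfty_z; have Lf := Kf.1.
have uv := unimodular_inner iv; have bv := uv.1.
pose k := fmul theta (fconj G).
have Hk : H2 k := H2_theta_conj bt bG KGz.
have bk : Linfty k := LinftyM bt (Linfty_conj bG).
have [Hg _] := og.
have bg := Linfty_outer_factor uv Hg.1.1 bG GE.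
have fk h : H2 h -> dot f (fmul k h) = 0.
  by move=> Hh; rewrite -dot_mul_theta; exact: ((KspaceP _ bt).1 KGf).2.
have HX := H2_zX.
have LX n : Linfty (fun t : R => zT t ^+ n) := LinftyX n bz.
have Hp (p : {poly R[i]}) : Linfty (fun t => p.[zT t]) := Linfty_horner p bz.
have Hz : H2 z by have := HX 1%N; congr H2; apply/funext => t.
have theta_zX n : dot f (fun t => theta t * zT t ^+ n) = 0.
  elim/ltn_ind: n => n IH.
  have [p [sp Hr]] := conj_mulX_split n Hg bg.
  set c := conjc (cintegral g) in Hr; set r := (fun t => _) in Hr.
  pose h := fmul z (fmul v (fun t => zT t ^+ n)).
  have Hh : H2 h by apply: H2M Hz bz _; apply: H2M iv.1.1 bv (HX n).
  have Hkh := H2M Hk bk Hh.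
  pose q t := c * zT t ^+ n + p.[zT t].
  have Hq : H2 q.
    have := H2_poly (c *: 'X^n + p); congr H2; apply/funext => t.
    by rewrite /q hornerD hornerZ hornerXn.
  have Ltq := L2M_bdd bt Hq.1.
  (* theta r = k (z v z^n) - theta q, because G = z v g makes k z v = theta conj g *)
  have tr : aeq (fun t => fmul k h t - fmul theta q t) (fmul theta r).
    move: uv.2 GE; apply: ae_imp2 => t /conjc_mul_unit vt;
      rewrite /k /h /q /r /fmul /fconj => ->.
    rewrite !conjcM.
    transitivity (theta t * (conjc (g t) * zT t ^+ n * ((conjc (v t) * v t) * (conjc
      (zT t) * zT t)))
      - theta t * (c * zT t ^+ n + p.[zT t])); first by ring.
    by rewrite vt conjc_zT_mul; ring.
  have Hdiff := H2B Hkh (H2M Ht bt Hq).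
  have Htr : H2 (fmul theta r) := H2_ae Hdiff (cmeasurableM bt.1 Hr.1.1) tr.
  have fr : dot f (fmul theta r) = 0 by exact: Kf.2 _ (Kspace_mul_H2minus ut Hr Htr).
  have fq : dot f (fmul theta q) = 0.
    have := dotBr Hkh.1 Ltq Lf; rewrite (dot_aeqr Hdiff.1 Htr.1 Lf tr) fr fk// sub0r.
    by move=> /eqP; rewrite eq_sym oppr_eq0 => /eqP.
  (* the induction disposes of theta q except for its leading term c theta z^n *)
  have fp : dot f (fun t => theta t * p.[zT t]) = 0.
    by apply: dot_mul_horner => // j jp; apply: IH; exact: leq_trans jp sp.
  have Ltp := L2M_bdd bt (Linfty_L2 (Hp p)).
  have : dot f (fun t => fmul theta q t - theta t * p.[zT t]) = 0.
    by rewrite (dotBr Ltq Ltp Lf) fq fp subrr.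
  rewrite /dot (_ : fmul _ _ = (fun t => conjc c * fmul f (fconj (fun t => theta t * zT
    t ^+ n)) t)); last first.
    by apply/funext => t; rewrite /fmul /fconj /q -mulrBr addrK !conjcM; ring.
  rewrite cintegralZ; last first.
    exact: L2_mul_integrable Lf (L2_conj (Linfty_L2 (LinftyM bt (LX n)))).
  move=> /eqP; rewrite mulf_eq0 conjcK (negbTE (outer_mean og)) /= => /eqP; exact.
exact: Kperp_orth_theta_zX ut Ht Kf theta_zX.
Qed.

(** From left to right, z v f is in H^2 because its product with the outer g is G f.
    From right to left, G f is orthogonal to theta H^2 because f is orthogonal to
    theta (conj G) H^2, a subset of H^2. *)
Lemma kerD_outer theta G v g f : inner theta -> Linfty G -> kerD theta G (fconj z) ->
  inner v -> outer g -> aeq G (fmul z (fmul v g)) ->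
  kerD theta G f <-> H2minus f /\ H2 (fmul (fmul z v) f).
Proof.
move=> it bG kz iv og GE.
have ut := unimodular_inner it; have uv := unimodular_inner iv.
have bt := ut.1; have bz := Linfty_z; have bv := uv.1.
have [_ KGz] := (kerDP _ bt bG).1 kz.
have [Hg _] := og.
have bg := Linfty_outer_factor uv Hg.1.1 bG GE.
have GfE : aeq (fmul G f) (fmul g (fmul (fmul z v) f)).
  by move: GE; apply: ae_imp => t; rewrite /fmul => ->; ring.
split.
  move=> /kerDP-/(_ bt bG)[Kf KGf].
  have Hf := kerD_sub_H2minus ut it.1.1 bG iv og GE KGz Kf KGf; split=> //.
  have Lwf := L2M_bdd (LinftyM bz bv) Kf.1.
  apply: (outer_div og Lwf).
  have := H2_ae KGf.1 (cmeasurableM Hg.1.1 Lwf.1) GfE; congr H2.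
  by apply/funext => t; rewrite /fmul mulrC.
move=> [Hf Hwf]; apply/kerDP => //; split; first exact: Kperp_H2minus.
apply/KspaceP => //; split.
  exact: H2_ae (H2M Hg bg Hwf) (cmeasurableM bG.1 Hf.1.1) (aeq_sym GfE).
move=> h Hh; rewrite dot_mul_theta; apply: Hf.2.
apply: H2M => //; first exact: H2_theta_conj.
exact: LinftyM bt (Linfty_conj bG).
Qed.

End DualTruncatedToeplitzKernel.

Theorem theorem4p12 (R : realType) (theta G : R -> R[i])
    (htheta : inner theta) (hG : Linfty G) :
  (* (i) *)
  ((kerD theta G (fconj zT) <-> (smul zT (Kspace theta) `&` Linfty) G) /\
   smul zT (Kspace theta) `&` Linfty `<=` smul zT Hinfty) /\
  (* (ii) *)
  (kerD theta G (fconj zT) -> ~ aeq G (fun=> 0) ->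
   forall Gi Go : R -> R[i],
     inner Gi -> outer Go -> aeq G (fmul zT (fmul Gi Go)) ->
     kerD theta G
       = smul (fconj zT) (smul (fconj Gi) (Kspace (fmul zT Gi))) /\
     smul (fconj zT) (smul (fconj Gi) (Kspace (fmul zT Gi)))
       = smul (fconj zT) (sconj (Kspace (fmul zT Gi)))).
Proof.
have bt := (unimodular_inner htheta).1.
split; first by split; [exact: kerD_conjz|exact: smul_z_Kspace_Hinfty].
move=> kz _ Gi Go iGi oGo GE; have ui := unimodular_inner iGi.
split; apply/seteqP; split=> f.
- by move=> /(kerD_outer f htheta hG kz iGi oGo GE)/(mem_conj_Kspace f ui).
- by move=> /(mem_conj_Kspace f ui)/(kerD_outer f htheta hG kz iGi oGo GE).
- by move=> /(mem_conj_Kspace f ui)/(mem_sconj_Kspace f ui).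
- by move=> /(mem_sconj_Kspace f ui)/(mem_conj_Kspace f ui).
Qed.
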